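(* Let $M^m$ ($m>1$) be a complete Kähler manifold with $m=\dim_{\mathbb{C}}(M)$ and complex structure $J$. Let $f\in C^\infty(M)$ be real-valued and assume $\nabla f(p)\neq 0$, where $p\in M$. Choose a unitary frame $e_\alpha\in T^{1,0}(M)$ ($\alpha=1,\dots,m$) near $p$ such that $e_1=\frac{1}{\sqrt2}(X-\sqrt{-1}JX)$, where $X=\frac{\nabla f}{|\nabla f|}$. Then, near $p$, $$\frac12\Big\langle \nabla f,\nabla\Big(\sum_{\gamma\neq1}f_{\gamma\overline{\gamma}}\Big)\Big\rangle=f_{1\overline1}\,\Delta f-|f_{\alpha\overline\beta}|^2+\mathrm{Re}(\mathrm{div}\,Y),$$ where $Y=\sum_{\gamma\neq1}\sum_{\alpha=1}^m f_{\overline\alpha}f_{\alpha\overline\gamma}e_\gamma$ and $\Delta f=\sum_{\alpha}f_{\alpha\overline\alpha}$.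
   Context: $\langle\cdot,\cdot\rangle$ is the Riemannian metric, extended complex-bilinearly to the complexified tangent bundle; writing $e_{\overline\alpha}=\overline{e_\alpha}$, a unitary frame satisfies $\langle e_\alpha,e_{\overline\beta}\rangle=\delta_{\alpha\beta}$. Write $f_{\alpha}=e_\alpha(f)$, $f_{\overline\alpha}=e_{\overline\alpha}(f)$, and $f_{\alpha\overline\beta}=\nabla^2f(e_\alpha,e_{\overline\beta})$ for the complex Hessian. With this convention $\Delta f=\sum_\alpha f_{\alpha\overline\alpha}$ is one half of the Laplace–Beltrami operator. $|f_{\alpha\overline\beta}|^2$ denotes $\sum_{\alpha,\beta=1}^m|f_{\alpha\overline\beta}|^2$. For a $(1,0)$ vector field $Y$, $\mathrm{div}\,Y=\sum_\beta\langle\nabla_{e_\beta}Y,e_{\overline\beta}\rangle$. $\nabla f$ is the real Riemannian gradient. *)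

(* Defs.v *)
From HB Require Import structures.
From mathcomp Require Import all_boot all_order all_algebra.
From mathcomp Require Import complex.
From mathcomp Require Import all_classical all_reals all_analysis.

Set Implicit Arguments.
Unset Strict Implicit.
Unset Printing Implicit Defensive.

Import Order.TTheory GRing.Theory Num.Theory.
Import numFieldNormedType.Exports.

Local Open Scope classical_set_scope.
Local Open Scope ring_scope.

(* Only meaningful for open D: [Ck_on] uses two-sided continuity and
   differentiability at the points of D. *)
Fixpoint Ck_on (R : realType) (n k : nat) (D : set 'rV[R]_n)
    (F : 'rV[R]_n -> R) : Prop :=
  (forall x, D x -> {for x, continuous F}) /\
  (if k is k'.+1 then
     forall i : 'I_n, (forall x, D x -> derivable F x (delta_mx 0 i)) /\
                      Ck_on k' D ('D_(delta_mx 0 i) F)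
   else True).

Definition smooth_on (R : realType) (n : nat) (D : set 'rV[R]_n)
    (F : 'rV[R]_n -> R) : Prop :=
  forall k, Ck_on k D F.

(* A chart z = x + iy into C^m, written with the 2m real coordinates
   (x_1, .., x_m, y_1, .., y_m).  The values of [cmap] outside [cdom] and of
   [cinv] outside the image of [cdom] are irrelevant. *)
Record chart (R : realType) (m : nat) (M : topologicalType) := Chart {
  cdom : set M;
  cmap : M -> 'rV[R]_(m + m);
  cinv : 'rV[R]_(m + m) -> M }.

Definition is_chart (R : realType) (m : nat) (M : topologicalType)
    (phi : chart R m M) : Prop :=
  [/\ open (cdom phi),
      open (cmap phi @` cdom phi),
      forall q, cdom phi q -> cinv phi (cmap phi q) = q,
      forall q, cdom phi q -> {for q, continuous (cmap phi)} &
      forall x, (cmap phi @` cdom phi) x -> {for x, continuous (cinv phi)}].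

Definition pd (R : realType) (m : nat) (M : topologicalType)
    (phi : chart R m M) (i : 'I_(m + m)) (h : M -> R) (q : M) : R :=
  'D_(delta_mx 0 i) (h \o cinv phi) (cmap phi q).

Definition smooth_in (R : realType) (m : nat) (M : topologicalType)
    (phi : chart R m M) (A : set M) (h : M -> R) : Prop :=
  smooth_on (cmap phi @` (A `&` cdom phi)) (h \o cinv phi).

(* Row-vector convention: tangent vectors at q are rows v of components with
   respect to the coordinate fields of a chart, and a change of chart from phi
   to phi' sends v to v *m jac phi phi' q. *)
Definition jac (R : realType) (m : nat) (M : topologicalType)
    (phi phi' : chart R m M) (q : M) : 'M[R]_(m + m) :=
  \matrix_(i, j) pd phi i (fun q' => cmap phi' q' 0 j) q.

(* v |-> v *m Jmx is multiplication by the imaginary unit of C^m: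
   d/dx_a |-> d/dy_a and d/dy_a |-> - d/dx_a. *)
Definition Jmx (R : pzRingType) (m : nat) : 'M[R]_(m + m) :=
  block_mx 0 1%:M (- 1%:M) 0.

(* A complex manifold of complex dimension m, given by a holomorphic atlas,
   with a Hermitian metric whose fundamental form is closed.  The metric is
   given by its components [metric phi q] in the chart phi at q, which are
   meaningful only for q in the domain of phi. *)
Record kahlerManifold (R : realType) (m : nat) := KahlerManifold {
  carrier :> topologicalType;
  carrier_hausdorff : hausdorff_space carrier;
  carrier_second_countable : @second_countable carrier;
  atlas : set (chart R m carrier);
  atlas_chart : forall phi, atlas phi -> is_chart phi;
  atlas_cover : forall q, exists2 phi, atlas phi & cdom phi q;
  atlas_smooth : forall phi phi', atlas phi -> atlas phi' ->
    forall j, smooth_in phi (cdom phi') (fun q => cmap phi' q 0 j);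
  (* the Cauchy-Riemann equations for the transition maps *)
  atlas_holomorphic : forall phi phi', atlas phi -> atlas phi' ->
    forall q, cdom phi q -> cdom phi' q ->
    jac phi phi' q *m Jmx R m = Jmx R m *m jac phi phi' q;
  metric : chart R m carrier -> carrier -> 'M[R]_(m + m);
  metric_smooth : forall phi, atlas phi ->
    forall i j, smooth_in phi (cdom phi) (fun q => metric phi q i j);
  metric_change : forall phi phi', atlas phi -> atlas phi' ->
    forall q, cdom phi q -> cdom phi' q ->
    metric phi q = jac phi phi' q *m metric phi' q *m (jac phi phi' q)^T;
  metric_sym : forall phi q, atlas phi -> cdom phi q ->
    (metric phi q)^T = metric phi q;
  metric_pos : forall phi q, atlas phi -> cdom phi q ->
    forall v : 'rV[R]_(m + m), v != 0 -> 0 < (v *m metric phi q *m v^T) 0 0;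
  metric_hermitian : forall phi q, atlas phi -> cdom phi q ->
    Jmx R m *m metric phi q *m (Jmx R m)^T = metric phi q;
  (* d omega = 0 for omega(u, v) = <J u, v> *)
  metric_kahler : forall phi q, atlas phi -> cdom phi q ->
    let omega i j q' := (Jmx R m *m metric phi q') i j in
    forall i j k, pd phi i (omega j k) q + pd phi j (omega k i) q
                  + pd phi k (omega i j) q = 0 }.

(* The Christoffel symbol Gamma^k_{ij} of the Levi-Civita connection. *)
Definition christoffel (R : realType) (m : nat) (M : kahlerManifold R m)
    (phi : chart R m M) (q : M) (i j k : 'I_(m + m)) : R :=
  2^-1 * \sum_l invmx (metric phi q) k l *
    (pd phi i (fun q' => metric phi q' j l) q
     + pd phi j (fun q' => metric phi q' i l) q
     - pd phi l (fun q' => metric phi q' i j) q).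

Definition geodesic (R : realType) (m : nat) (M : kahlerManifold R m)
    (c : R -> M) : Prop :=
  continuous c /\
  forall phi t, atlas phi -> cdom phi (c t) ->
    let x k s := cmap phi (c s) 0 k in
    forall k, [/\ derivable (x k) t 1, derivable (derive1 (x k)) t 1 &
      derive1 (derive1 (x k)) t
      + \sum_i \sum_j
          christoffel phi (c t) i j k * derive1 (x i) t * derive1 (x j) t
      = 0].

(* Every tangent vector is the initial velocity of a geodesic defined for all
   times. *)
Definition complete_manifold (R : realType) (m : nat) (M : kahlerManifold R m)
    : Prop :=
  forall (p : M) phi (v : 'rV[R]_(m + m)), atlas phi -> cdom phi p ->
    exists c : R -> M, [/\ geodesic c, c 0 = p &
      forall k, derive1 (fun s => cmap phi (c s) 0 k) 0 = v 0 k].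

Definition smooth_fun (R : realType) (m : nat) (M : kahlerManifold R m)
    (f : M -> R) : Prop :=
  forall phi, atlas phi -> smooth_in phi (cdom phi) f.

Definition grad (R : realType) (m : nat) (M : kahlerManifold R m)
    (f : M -> R) (phi : chart R m M) (q : M) : 'rV[R]_(m + m) :=
  (\row_i pd phi i f q) *m invmx (metric phi q).

Definition norm_grad (R : realType) (m : nat) (M : kahlerManifold R m)
    (f : M -> R) (phi : chart R m M) (q : M) : R :=
  Num.sqrt ((grad f phi q *m metric phi q *m (grad f phi q)^T) 0 0).

Definition hessian (R : realType) (m : nat) (M : kahlerManifold R m)
    (f : M -> R) (phi : chart R m M) (q : M) : 'M[R]_(m + m) :=
  \matrix_(i, j) (pd phi i (pd phi j f) q
                  - \sum_k christoffel phi q i j k * pd phi k f q).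

Definition cmx (R : realType) (a b : nat) (A : 'M[R]_(a, b)) : 'M[R[i]]_(a, b) :=
  map_mx (real_complex R) A.

Definition conj_vec (R : realType) (n : nat) (u : 'rV[R[i]]_n) : 'rV[R[i]]_n :=
  map_mx (@conjc R) u.

(* The complex-bilinear (not sesquilinear) extension of a real bilinear form. *)
Definition cbil (R : realType) (n : nat) (A : 'M[R]_n) (u v : 'rV[R[i]]_n) : R[i] :=
  (u *m cmx A *m v^T) 0 0.

Definition cpd (R : realType) (m : nat) (M : topologicalType)
    (phi : chart R m M) (i : 'I_(m + m)) (h : M -> R[i]) (q : M) : R[i] :=
  Complex (pd phi i (fun q' => complex.Re (h q')) q)
          (pd phi i (fun q' => complex.Im (h q')) q).

(* The complex-linear extension of [grad] to complex-valued functions. *)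
Definition cgrad (R : realType) (m : nat) (M : kahlerManifold R m)
    (h : M -> R[i]) (phi : chart R m M) (q : M) : 'rV[R[i]]_(m + m) :=
  (\row_i cpd phi i h q) *m cmx (invmx (metric phi q)).

(* A section of the complexified tangent bundle, by its components in each
   chart. *)
Definition cvfield (R : realType) (m : nat) (M : topologicalType) :=
  chart R m M -> M -> 'rV[R[i]]_(m + m).

Definition smooth_cvfield (R : realType) (m : nat) (M : kahlerManifold R m)
    (U : set M) (Y : cvfield R m M) : Prop :=
  (forall phi phi' q, atlas phi -> atlas phi' -> U q ->
     cdom phi q -> cdom phi' q -> Y phi' q = Y phi q *m cmx (jac phi phi' q)) /\
  (forall phi k, atlas phi ->
     smooth_in phi U (fun q => complex.Re (Y phi q 0 k)) /\
     smooth_in phi U (fun q => complex.Im (Y phi q 0 k))).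

(* T^{1,0} is the sqrt(-1)-eigenbundle of J. *)
Definition unitary_frame (R : realType) (m : nat) (M : kahlerManifold R m)
    (U : set M) (e : 'I_m -> cvfield R m M) : Prop :=
  (forall a, smooth_cvfield U (e a)) /\
  (forall phi q, atlas phi -> U q -> cdom phi q ->
     (forall a, e a phi q *m cmx (Jmx R m) = 'i%C *: e a phi q) /\
     (forall a b, cbil (metric phi q) (e a phi q) (conj_vec (e b phi q))
                  = (a == b)%:R)).

(* X - sqrt(-1) J X over sqrt 2, for X = grad f / |grad f| *)
Definition grad_frame_vector (R : realType) (m : nat) (M : kahlerManifold R m)
    (f : M -> R) : cvfield R m M :=
  fun phi q =>
    let X := (norm_grad f phi q)^-1 *: grad f phi q in
    (real_complex R (Num.sqrt 2))^-1 *: (cmx X - 'i%C *: cmx (X *m Jmx R m)).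

(* f_abar = conj(e_a)(f) *)
Definition fbar (R : realType) (m : nat) (M : kahlerManifold R m)
    (f : M -> R) (e : 'I_m -> cvfield R m M) (a : 'I_m)
    (phi : chart R m M) (q : M) : R[i] :=
  \sum_i conj_vec (e a phi q) 0 i * real_complex R (pd phi i f q).

(* f_{a bbar} = (Hess f)(e_a, conj e_b) *)
Definition chess (R : realType) (m : nat) (M : kahlerManifold R m)
    (f : M -> R) (e : 'I_m -> cvfield R m M) (a b : 'I_m)
    (phi : chart R m M) (q : M) : R[i] :=
  cbil (hessian f phi q) (e a phi q) (conj_vec (e b phi q)).

(* The Levi-Civita connection, extended complex-bilinearly: nabla_u Y at q. *)
Definition nabla (R : realType) (m : nat) (M : kahlerManifold R m)
    (u : 'rV[R[i]]_(m + m)) (Y : cvfield R m M)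
    (phi : chart R m M) (q : M) : 'rV[R[i]]_(m + m) :=
  \row_k \sum_i u 0 i * (cpd phi i (fun q' => Y phi q' 0 k) q
    + \sum_j real_complex R (christoffel phi q i j k) * Y phi q 0 j).

Definition cdiv (R : realType) (m : nat) (M : kahlerManifold R m)
    (e : 'I_m -> cvfield R m M) (Y : cvfield R m M)
    (phi : chart R m M) (q : M) : R[i] :=
  \sum_b cbil (metric phi q) (nabla (e b phi q) Y phi q)
              (conj_vec (e b phi q)).

(* Main.v *)
Require Import Defs.
From HB Require Import structures.
From mathcomp Require Import all_boot all_order all_algebra.
From mathcomp Require Import complex.
From mathcomp Require Import all_classical all_reals all_analysis.
From mathcomp Require Import ring.

Set Implicit Arguments.
Unset Strict Implicit.
Unset Printing Implicit Defensive.

Import Order.TTheory GRing.Theory Num.Theory.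
Import numFieldNormedType.Exports.

Local Open Scope classical_set_scope.
Local Open Scope ring_scope.

(** The identity is the real part of a computation of [div Y], with no curvature
    involved. Write V for the (1,0) part of the gradient, of components
    [f_{abar}]. Since e_1 is proportional to V, the frame is adapted:
    [f_{abar} = 0] for a different from 1 ([fbar_eq0]). Hence adding the missing
    term c = 1 to Y gives the field W dual to [f_{abar} f_{a cbar}], and the
    term added is [f_{1 1bar} V] ([tangential_fieldE]). The Leibniz rule gives

      div W = |f_{a bbar}|^2 + V(Lap f)                 ([hessian_grad_div]),
      div (f_{1 1bar} V) = f_{1 1bar} Lap f + V(f_{1 1bar}) ([scaled_grad_div]),

    the first one because the divergence of the complex Hessian is the
    derivative of its trace. Subtracting, V is applied to
    [Lap f - f_{1 1bar}], the sum of the other [f_{c cbar}]; this function is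
    real, so the real part of the outcome is half its derivative along the
    gradient ([Re_cdir_grad10]).

    To make this precise without covariant third derivatives, everything is
    computed in one holomorphic chart. The Kahler condition makes the
    derivatives of the metric symmetric in indices of equal type
    ([kahler_swap]), so Christoffel symbols with lower indices of opposite types
    vanish ([first_kind_mixed]). Therefore the complex Hessian consists of plain
    second derivatives ([hessian_mixed]), and the divergence of a (1,0) field is
    a plain derivative of its dual 1-form ([nabla_mixed]). The frame is traded
    for the mixed part [G] of the inverse metric ([frame_dual]), whose derivative
    is [- G (dg) G] ([dmx_frame_dual]). What remains is matrix algebra, with three
    inputs: the symmetry of the third derivatives of f, which rests on the
    equality of mixed partial derivatives ([derive_comm]), the symmetry
    [kahler_swap], and the cyclicity of the trace, which makes the derivatives
    of the metric cancel ([trace_rearrange]).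

    All of this holds at every point of U, not only near p. *)

(** * Algebraic preliminaries *)

(** The cyclic rotation that aligns the three contractions of a trilinear form. *)
Lemma sum_rot (V : nmodType) (I : finType) (F : I -> I -> I -> V) :
  \sum_i \sum_j \sum_k F i j k = \sum_i \sum_j \sum_k F j k i.
Proof.
rewrite [RHS]exchange_big; apply: eq_bigr => i _ /=.
by rewrite exchange_big.
Qed.

(** The trace identity behind the cancellation of the derivatives of the metric:
    with A the Hessian, C its derivative, D the inverse metric and B the
    derivative of the metric, the last term is the derivative of the trace of
    A D. *)
Lemma trace_rearrange (K : comNzRingType) n (A B C D : 'M[K]_n) :
  \tr ((A *m D *m A - B *m D *m A + C) *m D)
  = \tr (A *m D *m A *m D) + \tr (C *m D + A *m - (D *m B *m D)).
Proof.
rewrite mulmxDl mulmxBl mulmxN !raddfD !raddfN /= -addrA.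
have -> : \tr (B *m D *m A *m D) = \tr (A *m (D *m B *m D)).
  by rewrite -mulmxA mxtrace_mulC !mulmxA.
by congr (_ + _); rewrite addrC.
Qed.

Section ComplexMatrices.
Variable R : realType.

Lemma ReD (x y : R[i]) : complex.Re (x + y) = complex.Re x + complex.Re y.
Proof. by case: x y => [a b] [c d]. Qed.

Lemma ImD (x y : R[i]) : complex.Im (x + y) = complex.Im x + complex.Im y.
Proof. by case: x y => [a b] [c d]. Qed.

Lemma ReM (x y : R[i]) :
  complex.Re (x * y) = complex.Re x * complex.Re y - complex.Im x * complex.Im y.
Proof. by case: x y => [a b] [c d]. Qed.

Lemma ImM (x y : R[i]) :
  complex.Im (x * y) = complex.Re x * complex.Im y + complex.Im x * complex.Re y.
Proof. by case: x y => [a b] [c d]. Qed.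

Lemma sqr_ii : 'i%C * 'i%C = -1 :> R[i].
Proof. by rewrite -expr2 sqr_i. Qed.

Lemma cmxM (a b d : nat) (A : 'M[R]_(a, b)) (B : 'M[R]_(b, d)) :
  cmx (A *m B) = cmx A *m cmx B.
Proof. exact: map_mxM. Qed.

Lemma cmx_tr (a b : nat) (A : 'M[R]_(a, b)) : cmx A^T = (cmx A)^T.
Proof. by rewrite /cmx map_trmx. Qed.

Lemma conj_cmx (k l : nat) (A : 'M[R]_(k, l)) : map_mx (@conjc R) (cmx A) = cmx A.
Proof. by apply/matrixP => x y; rewrite !mxE conjc_real. Qed.

Lemma conjc_mxK (k l : nat) (A : 'M[R[i]]_(k, l)) :
  map_mx (@conjc R) (map_mx (@conjc R) A) = A.
Proof. by apply/matrixP => x y; rewrite !mxE conjcK. Qed.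

Lemma trmx11 (A : 'M[R[i]]_1) : A^T = A.
Proof. by apply/matrixP => a b; rewrite mxE !ord1. Qed.

End ComplexMatrices.

(** * Equality of mixed partial derivatives *)

Section Schwarz.
Variables (R : realType) (V : normedModType R).
Implicit Types (F : V -> R) (x v w : V).

Lemma is_derive_line F x v (s : R) : derivable F (s *: v + x) v ->
  is_derive s (1 : R) (fun t : R => F (t *: v + x)) ('D_v F (s *: v + x)).
Proof.
move=> dF.
have E : (fun h : R => h^-1 *: (F ((h *: (1 : R) + s) *: v + x) - F (s *: v + x)))
       = (fun h : R => h^-1 *: (F (h *: v + (s *: v + x)) - F (s *: v + x))).
  by apply/funext => h; rewrite [h *: (1 : R)]mulr1 scalerDl addrA.
split.
  by rewrite /derivable /= E.
by rewrite /derive /= E.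
Qed.

(** The mean value theorem, used first along v and then along w. *)
Lemma second_difference F x v w (h : R) : 0 <= h ->
  (forall a b, 0 <= a <= h -> 0 <= b <= h ->
     derivable F (a *: v + b *: w + x) v /\
     derivable ('D_v F) (a *: v + b *: w + x) w) ->
  exists a b, [/\ 0 <= a <= h, 0 <= b <= h &
    F (h *: v + h *: w + x) - F (h *: v + x) - F (h *: w + x) + F x
    = 'D_w ('D_v F) (a *: v + b *: w + x) * h * h].
Proof.
move=> h0 dF.
have h0' : 0 <= h <= h by rewrite h0 lexx.
have z0' : 0 <= (0 : R) <= h by rewrite h0 lexx.
have dF1 s b : 0 <= s <= h -> 0 <= b <= h ->
    is_derive s (1 : R) (fun t : R => F (t *: v + (b *: w + x)))
                        ('D_v F (s *: v + b *: w + x)).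
  move=> hs hb; rewrite -addrA; apply: is_derive_line.
  by rewrite addrA; apply: (dF _ _ hs hb).1.
pose p (t : R) := F (t *: v + (h *: w + x)) - F (t *: v + (0 *: w + x)).
have dp s : 0 <= s <= h -> is_derive s (1 : R) p
    ('D_v F (s *: v + h *: w + x) - 'D_v F (s *: v + 0 *: w + x)).
  by move=> hs; apply: is_deriveB; apply: dF1.
have [||a] := @MVT_segment R p (fun s => 'D_v F (s *: v + h *: w + x) -
    'D_v F (s *: v + 0 *: w + x)) 0 h h0.
- move=> s /andP[s0 sh]; apply: dp.
  by move: s0 sh; rewrite !bnd_simp => /ltW -> /ltW ->.
- apply: derivable_within_continuous => s.
  by rewrite in_itv /= => hs; case: (dp s hs).
rewrite in_itv /= subr0 => ha pE.
have dF2 s : 0 <= s <= h -> is_derive s (1 : R)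
    (fun t : R => 'D_v F (t *: w + (a *: v + x)))
    ('D_w ('D_v F) (s *: w + (a *: v + x))).
  move=> hs; apply: is_derive_line.
  by rewrite addrA [s *: w + _]addrC; apply: (dF _ _ ha hs).2.
have [||b] := @MVT_segment R (fun t : R => 'D_v F (t *: w + (a *: v + x)))
    (fun t => 'D_w ('D_v F) (t *: w + (a *: v + x))) 0 h h0.
- move=> s /andP[s0 sh]; apply: dF2.
  by move: s0 sh; rewrite !bnd_simp => /ltW -> /ltW ->.
- apply: derivable_within_continuous => s.
  by rewrite in_itv /= => hs; case: (dF2 s hs).
rewrite in_itv /= subr0 => hb qE.
exists a, b; split=> //.
move: qE pE; rewrite /p !scale0r !addr0 !add0r !addrA ![_ *: w + a *: v]addrC.
by move=> -> <-; ring.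
Qed.

(** The second difference is symmetric in v and w, so each iterated derivative
    takes, somewhere in an arbitrarily small box at x, the value of the other at
    a second point of that box; continuity at x then makes them equal. *)
Lemma derive_comm F x v w :
  (\forall y \near x, [/\ derivable F y v, derivable F y w,
     derivable ('D_v F) y w & derivable ('D_w F) y v]) ->
  {for x, continuous ('D_w ('D_v F))} -> {for x, continuous ('D_v ('D_w F))} ->
  'D_w ('D_v F) x = 'D_v ('D_w F) x.
Proof.
move=> dF c1 c2.
apply/eqP; rewrite -subr_eq0 -normr_le0; apply/ler_addgt0Pr => e e0.
have e2 : 0 < e / 2 by rewrite divr_gt0.
have /nbhs_ballP[r /= r0 rP] : \forall y \near x,
    [/\ derivable F y v, derivable F y w,
        derivable ('D_v F) y w & derivable ('D_w F) y v] /\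
    (`|'D_w ('D_v F) x - 'D_w ('D_v F) y| < e / 2 /\
     `|'D_v ('D_w F) x - 'D_v ('D_w F) y| < e / 2).
  apply: filterI => //; apply: filterI.
    by move/cvgrPdist_lt: c1; apply.
  by move/cvgrPdist_lt: c2; apply.
(* h is small enough for the box spanned by h v and h w to lie in the ball. *)
pose K := `|v| + `|w| + 1.
have K0 : 0 < K by rewrite ltr_wpDl // addr_ge0.
pose h := r / 2 / K.
have h0 : 0 < h by rewrite !divr_gt0.
have box a b : 0 <= a <= h -> 0 <= b <= h -> ball x r (a *: v + b *: w + x).
  move=> /andP[a0 ah] /andP[b0 bh].
  rewrite -ball_normE /= opprD addrCA subrr addr0 normrN.
  apply: (@le_lt_trans _ _ (h * K)).
    rewrite (le_trans (ler_normD _ _)) // !normrZ !ger0_norm // mulrDr mulr1.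
    rewrite ler_wpDr ?(ltW h0) // mulrDr.
    by apply: lerD; apply: ler_wpM2r.
  by rewrite /h divfK ?gt_eqF // ltr_pdivrMr // ltr_pMr // ltr1n.
have box' b a : 0 <= b <= h -> 0 <= a <= h -> ball x r (b *: w + a *: v + x).
  by move=> hb ha; rewrite (addrC (b *: w)); apply: box.
have [|a [b [ha hb E1]]] := @second_difference F x v w h (ltW h0).
  by move=> a b ha hb; have [[]] := rP _ (box _ _ ha hb).
have [|b' [a' [hb' ha' E2]]] := @second_difference F x w v h (ltW h0).
  by move=> b' a' hb' ha'; have [[]] := rP _ (box' _ _ hb' ha').
have [_ [n1 _]] := rP _ (box _ _ ha hb).
have [_ [_ n2]] := rP _ (box' _ _ hb' ha').
move: E1 E2 n1 n2.
move: ('D_w ('D_v F) x) ('D_w ('D_v F) _) ('D_v ('D_w F) x) ('D_v ('D_w F) _).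
move=> A1 A2 B1 B2 E1 E2 n1 n2.
have EE : A2 = B2.
  have hn : h != 0 by rewrite gt_eqF.
  apply: (mulIf hn); apply: (mulIf hn).
  by rewrite -E1 -E2 (addrC (h *: w) (h *: v)); ring.
rewrite add0r (splitr e) -(subrKA A2).
apply: (le_trans (ler_normD _ _)); apply: lerD; first exact: ltW n1.
by rewrite EE distrC; apply: ltW n2.
Qed.

End Schwarz.

(** * Calculus in a chart *)

Section ChartCalculus.
Variables (R : realType) (m : nat) (M : topologicalType) (phi : chart R m M).
Hypothesis phi_chart : is_chart phi.
Variable A : set M.
Hypothesis A_open : open A.
Implicit Types (q : M) (i j : 'I_(m + m)).

Local Notation img := (cmap phi @` (A `&` cdom phi)).

(** Derivatives at q are insensitive to what happens outside the open set A:
    near the image of q, the inverse of the chart takes values in A. *)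
Lemma near_chart q : A q -> cdom phi q ->
  \forall x \near cmap phi q, img x /\ cmap phi (cinv phi x) = x.
Proof.
case: phi_chart => _ oimg invK _ inv_cont Aq cq.
have imgq : (cmap phi @` cdom phi) (cmap phi q) by exists q.
have n1 : \forall x \near cmap phi q, (cmap phi @` cdom phi) x.
  exact: open_nbhs_nbhs.
have n2 : \forall x \near cmap phi q, A (cinv phi x).
  have := inv_cont _ imgq; rewrite /prop_for /continuous_at invK //; apply.
  exact: open_nbhs_nbhs.
near=> x.
have [q' cq' E] : (cmap phi @` cdom phi) x by near: x.
have : A (cinv phi x) by near: x.
by rewrite -E invK // => Aq'; split => //; exists q'.
Unshelve. all: by end_near. Qed.

Lemma open_img : open img.
Proof.
rewrite openE => _ [q [Aq cq] <-].
by apply: filterS (near_chart Aq cq) => x [].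
Qed.

Lemma near_chart_eq (T : Type) (h1 h2 : M -> T) q :
  (forall q', A q' -> cdom phi q' -> h1 q' = h2 q') -> A q -> cdom phi q ->
  {near cmap phi q, h1 \o cinv phi =1 h2 \o cinv phi}.
Proof.
case: phi_chart => _ _ invK _ _ E Aq cq.
by apply: filterS (near_chart Aq cq) => _ [[q' [Aq' cq'] <-] _]; rewrite /= invK // E.
Qed.

Lemma pd_congr (h1 h2 : M -> R) i q :
  (forall q', A q' -> cdom phi q' -> h1 q' = h2 q') -> A q -> cdom phi q ->
  pd phi i h1 q = pd phi i h2 q.
Proof. by move=> E Aq cq; apply/near_eq_derive/near_chart_eq. Qed.

Lemma Ck_on_congr (n k : nat) (D : set 'rV[R]_n) (F G : 'rV[R]_n -> R) :
  open D -> {in D, F =1 G} -> Ck_on k D F -> Ck_on k D G.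
Proof.
move=> oD; elim: k F G => [|k IH] F G FG [cF dF].
all: have nFG x : D x -> {near x, F =1 G} by
  move=> Dx; apply: filterS (open_nbhs_nbhs (conj oD Dx)) => y Dy;
  apply: FG; rewrite inE.
all: split=> [x Dx|//].
- rewrite /prop_for /continuous_at -(FG x) ?inE //.
  exact: (cvg_trans (near_eq_cvg (nFG x Dx)) (cF x Dx)).
- rewrite /prop_for /continuous_at -(FG x) ?inE //.
  exact: (cvg_trans (near_eq_cvg (nFG x Dx)) (cF x Dx)).
- move=> i; have [d1 d2] := dF i; split.
    by move=> y Dy; apply: near_eq_derivable (d1 y Dy); apply: nFG.
  apply: IH d2 => y; rewrite inE => Dy.
  by apply: near_eq_derive; apply: nFG.
Qed.

(** Off the image of the chart, [pd phi i h] read in the chart and the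
    derivative of h read in the chart are unrelated, hence the appeal to
    [Ck_on_congr]. *)
Lemma smooth_in_pd (h : M -> R) i :
  smooth_in phi A h -> smooth_in phi A (pd phi i h).
Proof.
move=> sh k; have [_ /(_ i) [_ d2]] := sh k.+1.
apply: Ck_on_congr d2; first exact: open_img.
case: phi_chart => _ _ invK _ _ _ /set_mem [q [Aq cq] <-].
by rewrite /= /pd invK.
Qed.

(** Existence of the partial derivatives at one point is all that the Leibniz
    rule for [pd phi i] asks for: by the definition of [smooth_on], everything
    is differentiated along coordinate lines only. *)
Definition rdiff (h : M -> R) q :=
  forall i, derivable (h \o cinv phi) (cmap phi q) (delta_mx 0 i).

Lemma smooth_rdiff (h : M -> R) q :
  smooth_in phi A h -> A q -> cdom phi q -> rdiff h q.
Proof.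
by move=> sh Aq cq i; have [_ /(_ i) [d1 _]] := sh 1%N; apply: d1; exists q.
Qed.

Lemma pd_comm (h : M -> R) i j q : smooth_in phi A h -> A q -> cdom phi q ->
  pd phi i (pd phi j h) q = pd phi j (pd phi i h) q.
Proof.
move=> sh Aq cq; pose F := h \o cinv phi.
have iq : img (cmap phi q) by exists q.
have pdE k l : pd phi k (pd phi l h) q
    = 'D_(delta_mx 0 k) ('D_(delta_mx 0 l) F) (cmap phi q).
  apply: near_eq_derive; apply: filterS (near_chart Aq cq) => x [_ xK].
  by rewrite /= /pd xK.
rewrite !pdE; have [_ d1] := sh 2%N; apply: derive_comm.
- apply: filterS (open_nbhs_nbhs (conj open_img iq)) => y Dy.
  have [di [_ /(_ j) [dji _]]] := d1 i; have [dj [_ /(_ i) [dij _]]] := d1 j.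
  by split; [exact: dj | exact: di | exact: dij | exact: dji].
- by have [_ [_ /(_ i) [_ []]]] := d1 j => c _; apply: c.
- by have [_ [_ /(_ j) [_ []]]] := d1 i => c _; apply: c.
Qed.

Lemma rdiffD (h1 h2 : M -> R) q :
  rdiff h1 q -> rdiff h2 q -> rdiff (fun q' => h1 q' + h2 q') q.
Proof. by move=> d1 d2 i; apply: (derivableD (d1 i) (d2 i)). Qed.

Lemma rdiffB (h1 h2 : M -> R) q :
  rdiff h1 q -> rdiff h2 q -> rdiff (fun q' => h1 q' - h2 q') q.
Proof. by move=> d1 d2 i; apply: (derivableB (d1 i) (d2 i)). Qed.

Lemma rdiffM (h1 h2 : M -> R) q :
  rdiff h1 q -> rdiff h2 q -> rdiff (fun q' => h1 q' * h2 q') q.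
Proof. by move=> d1 d2 i; apply: (derivableM (d1 i) (d2 i)). Qed.

Lemma rdiff_cst (c : R) q : rdiff (fun=> c) q.
Proof. by move=> i; apply: (derivable_cst c). Qed.

Lemma pd_cst i (c : R) q : pd phi i (fun=> c) q = 0.
Proof. exact: (derive_cst c). Qed.

Lemma pdD i (h1 h2 : M -> R) q : rdiff h1 q -> rdiff h2 q ->
  pd phi i (fun q' => h1 q' + h2 q') q = pd phi i h1 q + pd phi i h2 q.
Proof. by move=> d1 d2; apply: (deriveD (d1 i) (d2 i)). Qed.

Lemma pdB i (h1 h2 : M -> R) q : rdiff h1 q -> rdiff h2 q ->
  pd phi i (fun q' => h1 q' - h2 q') q = pd phi i h1 q - pd phi i h2 q.
Proof. by move=> d1 d2; apply: (deriveB (d1 i) (d2 i)). Qed.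

Lemma pdM i (h1 h2 : M -> R) q : cdom phi q ->
  rdiff h1 q -> rdiff h2 q ->
  pd phi i (fun q' => h1 q' * h2 q') q
  = pd phi i h1 q * h2 q + h1 q * pd phi i h2 q.
Proof.
case: phi_chart => _ _ invK _ _ cq d1 d2; rewrite /pd.
have := deriveM (d1 i) (d2 i); rewrite /= invK // => ->.
by rewrite addrC [h2 q *: _]mulrC.
Qed.

End ChartCalculus.

(** * Calculus of complex matrix fields *)

Section ComplexCalculus.
Variables (R : realType) (m : nat) (M : topologicalType) (phi : chart R m M).
Hypothesis phi_chart : is_chart phi.
Implicit Types (q : M) (i : 'I_(m + m)) (h : M -> R[i]) (u v w : 'rV[R[i]]_(m + m)).

Definition cdiff h q :=
  rdiff phi (fun q' => complex.Re (h q')) q /\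
  rdiff phi (fun q' => complex.Im (h q')) q.

Lemma cdiff_cst (c : R[i]) q : cdiff (fun=> c) q.
Proof. by split; apply: rdiff_cst. Qed.

Lemma cdiffD h1 h2 q : cdiff h1 q -> cdiff h2 q ->
  cdiff (fun q' => h1 q' + h2 q') q.
Proof.
move=> [r1 i1] [r2 i2]; split.
  by under eq_fun do rewrite ReD; apply: rdiffD.
by under eq_fun do rewrite ImD; apply: rdiffD.
Qed.

Lemma cdiffM h1 h2 q : cdiff h1 q -> cdiff h2 q ->
  cdiff (fun q' => h1 q' * h2 q') q.
Proof.
move=> [r1 i1] [r2 i2]; split.
  by under eq_fun do rewrite ReM; apply: rdiffB; apply: rdiffM.
by under eq_fun do rewrite ImM; apply: rdiffD; apply: rdiffM.
Qed.

Lemma cdiff_sum (I : Type) (r : seq I) (P : pred I) (F : I -> M -> R[i]) q :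
  (forall a, cdiff (F a) q) -> cdiff (fun q' => \sum_(a <- r | P a) F a q') q.
Proof.
move=> dF; elim: r => [|a r IH].
  by under eq_fun do rewrite big_nil; apply: cdiff_cst.
under eq_fun do rewrite big_cons.
by case: (P a); [exact: (cdiffD (dF a) IH) | exact: IH].
Qed.

Lemma cdiff_real (h : M -> R) q : rdiff phi h q ->
  cdiff (fun q' => real_complex R (h q')) q.
Proof. by move=> dh; split; [exact: dh | exact: rdiff_cst]. Qed.

Lemma cdiff_conj h q : cdiff h q -> cdiff (fun q' => conjc (h q')) q.
Proof.
move=> [r1 i1]; split.
  have -> : (fun q' => complex.Re (conjc (h q'))) = fun q' => complex.Re (h q').
    by apply/funext => q'; case: (h q').
  exact: r1.
have -> : (fun q' => complex.Im (conjc (h q')))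
        = fun q' => 0 - complex.Im (h q').
  by apply/funext => q'; case: (h q') => x y /=; rewrite sub0r.
by apply: rdiffB; [exact: rdiff_cst | exact: i1].
Qed.

Definition cdir u h q : R[i] := \sum_i u 0 i * cpd phi i h q.

Lemma cpdD i h1 h2 q : cdiff h1 q -> cdiff h2 q ->
  cpd phi i (fun q' => h1 q' + h2 q') q = cpd phi i h1 q + cpd phi i h2 q.
Proof.
move=> [r1 i1] [r2 i2]; rewrite /cpd.
rewrite (funext (fun q' => ReD (h1 q') (h2 q'))) (funext (fun q' => ImD (h1 q') (h2 q'))).
by rewrite (pdD _ r1 r2) (pdD _ i1 i2).
Qed.

Lemma cpdM i h1 h2 q : cdom phi q -> cdiff h1 q -> cdiff h2 q ->
  cpd phi i (fun q' => h1 q' * h2 q') q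
  = cpd phi i h1 q * h2 q + h1 q * cpd phi i h2 q.
Proof.
move=> cq [r1 i1] [r2 i2]; rewrite /cpd.
rewrite (funext (fun q' => ReM (h1 q') (h2 q'))) (funext (fun q' => ImM (h1 q') (h2 q'))).
rewrite (pdB _ (rdiffM r1 r2) (rdiffM i1 i2)) (pdD _ (rdiffM r1 i2) (rdiffM i1 r2)).
rewrite (pdM phi_chart _ cq r1 r2) (pdM phi_chart _ cq i1 i2).
rewrite (pdM phi_chart _ cq r1 i2) (pdM phi_chart _ cq i1 r2).
 case: (h1 q) (h2 q) => [a b] [c d].
by apply/eqP; rewrite eq_complex /=; apply/andP; split; apply/eqP; ring.
Qed.

Lemma cpd_real i (h : M -> R) q :
  cpd phi i (fun q' => real_complex R (h q')) q = real_complex R (pd phi i h q).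
Proof. by rewrite /cpd /= pd_cst. Qed.

Lemma cdir_cst u (c : R[i]) q : cdir u (fun=> c) q = 0.
Proof. by rewrite /cdir big1 // => i _; rewrite /cpd !pd_cst mulr0. Qed.

Lemma cdirD u h1 h2 q : cdiff h1 q -> cdiff h2 q ->
  cdir u (fun q' => h1 q' + h2 q') q = cdir u h1 q + cdir u h2 q.
Proof.
move=> d1 d2; rewrite /cdir -big_split /=.
by apply: eq_bigr => i _; rewrite (cpdD _ d1 d2) mulrDr.
Qed.

Lemma cdirM u h1 h2 q : cdom phi q -> cdiff h1 q -> cdiff h2 q ->
  cdir u (fun q' => h1 q' * h2 q') q = cdir u h1 q * h2 q + h1 q * cdir u h2 q.
Proof.
move=> cq d1 d2; rewrite /cdir mulr_sumr mulr_suml -big_split /=.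
by apply: eq_bigr => i _; rewrite (cpdM _ cq d1 d2); ring.
Qed.

Lemma cdir_sum u (I : Type) (r : seq I) (P : pred I) (F : I -> M -> R[i]) q :
  (forall a, cdiff (F a) q) ->
  cdir u (fun q' => \sum_(a <- r | P a) F a q') q
  = \sum_(a <- r | P a) cdir u (F a) q.
Proof.
move=> dF; elim: r => [|a r IH].
  by under eq_fun do rewrite big_nil; rewrite cdir_cst big_nil.
rewrite big_cons; under eq_fun do rewrite big_cons.
case: (P a); last exact: IH.
by rewrite (cdirD _ (dF a) (cdiff_sum r P dF)) IH.
Qed.

Lemma cdir_suml (I : finType) (c : I -> R[i]) (u : I -> 'rV_(m + m)) h q :
  cdir (\sum_a c a *: u a) h q = \sum_a c a * cdir (u a) h q.
Proof.
rewrite /cdir; under [RHS]eq_bigr do rewrite mulr_sumr.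
rewrite exchange_big /=; apply: eq_bigr => i _.
rewrite summxE mulr_suml; apply: eq_bigr => a _.
by rewrite mxE mulrA.
Qed.

Definition mxdiff (a b : nat) (A : M -> 'M[R[i]]_(a, b)) q :=
  forall k l, cdiff (fun q' => A q' k l) q.

(** Vector and tensor fields are differentiated entrywise in the chart, with no
    connection involved, so that the Leibniz rule is the one of matrix
    products; u is the row of components of a complex tangent vector. *)
Definition dmx (a b : nat) u (A : M -> 'M[R[i]]_(a, b)) q : 'M[R[i]]_(a, b) :=
  \matrix_(k, l) cdir u (fun q' => A q' k l) q.

Lemma mxdiff_cst (a b : nat) (A : 'M[R[i]]_(a, b)) q : mxdiff (fun=> A) q.
Proof. by move=> k l; apply: cdiff_cst. Qed.

Lemma mxdiffM (a b c : nat) (A : M -> 'M[R[i]]_(a, b)) (B : M -> 'M[R[i]]_(b, c)) q :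
  mxdiff A q -> mxdiff B q -> mxdiff (fun q' => A q' *m B q') q.
Proof.
move=> dA dB k l; under eq_fun do rewrite mxE.
by apply: cdiff_sum => j; apply: cdiffM; [exact: dA | exact: dB].
Qed.

Lemma mxdiffD (a b : nat) (A B : M -> 'M[R[i]]_(a, b)) q :
  mxdiff A q -> mxdiff B q -> mxdiff (fun q' => A q' + B q') q.
Proof.
move=> dA dB k l; under eq_fun do rewrite mxE.
by apply: cdiffD; [exact: dA | exact: dB].
Qed.

Lemma mxdiffZ (a b : nat) h (A : M -> 'M[R[i]]_(a, b)) q :
  cdiff h q -> mxdiff A q -> mxdiff (fun q' => h q' *: A q') q.
Proof.
move=> dh dA k l; under eq_fun do rewrite mxE.
by apply: cdiffM; [exact: dh | exact: dA].
Qed.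

Lemma mxdiff_tr (a b : nat) (A : M -> 'M[R[i]]_(a, b)) q :
  mxdiff A q -> mxdiff (fun q' => (A q')^T) q.
Proof. by move=> dA k l; under eq_fun do rewrite mxE; exact: dA. Qed.

Lemma dmx_cst (a b : nat) u (A : 'M[R[i]]_(a, b)) q : dmx u (fun=> A) q = 0.
Proof. by apply/matrixP => k l; rewrite !mxE cdir_cst. Qed.

Lemma dmxD (a b : nat) u (A B : M -> 'M[R[i]]_(a, b)) q :
  mxdiff A q -> mxdiff B q ->
  dmx u (fun q' => A q' + B q') q = dmx u A q + dmx u B q.
Proof.
move=> dA dB; apply/matrixP => k l; rewrite !mxE.
by under eq_fun do rewrite mxE; exact: (cdirD _ (dA k l) (dB k l)).
Qed.

Lemma dmxZ (a b : nat) u h (A : M -> 'M[R[i]]_(a, b)) q :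
  cdom phi q -> cdiff h q -> mxdiff A q ->
  dmx u (fun q' => h q' *: A q') q = cdir u h q *: A q + h q *: dmx u A q.
Proof.
move=> cq dh dA; apply/matrixP => k l; rewrite !mxE.
by under eq_fun do rewrite mxE; exact: (cdirM _ cq dh (dA k l)).
Qed.

Lemma dmxM (a b c : nat) u (A : M -> 'M[R[i]]_(a, b))
    (B : M -> 'M[R[i]]_(b, c)) q :
  cdom phi q -> mxdiff A q -> mxdiff B q ->
  dmx u (fun q' => A q' *m B q') q = dmx u A q *m B q + A q *m dmx u B q.
Proof.
move=> cq dA dB; apply/matrixP => k l; rewrite !mxE -big_split /=.
have -> : (fun q' => (A q' *m B q') k l)
        = (fun q' => \sum_j A q' k j * B q' j l).
  by apply/funext => q'; rewrite mxE.
rewrite cdir_sum => [|j]; last by apply: cdiffM; [exact: dA | exact: dB].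
by apply: eq_bigr => j _; rewrite (cdirM _ cq (dA k j) (dB j l)) !mxE.
Qed.

Lemma dmxMcl (a b c : nat) u (A : 'M[R[i]]_(a, b))
    (B : M -> 'M[R[i]]_(b, c)) q : cdom phi q -> mxdiff B q ->
  dmx u (fun q' => A *m B q') q = A *m dmx u B q.
Proof.
move=> cq dB; rewrite dmxM; [|exact: cq|exact: mxdiff_cst|exact: dB].
by rewrite dmx_cst mul0mx add0r.
Qed.

Lemma dmxMcr (a b c : nat) u (A : M -> 'M[R[i]]_(a, b))
    (B : 'M[R[i]]_(b, c)) q : cdom phi q -> mxdiff A q ->
  dmx u (fun q' => A q' *m B) q = dmx u A q *m B.
Proof.
move=> cq dA; rewrite dmxM; [|exact: cq|exact: dA|exact: mxdiff_cst].
by rewrite dmx_cst mulmx0 addr0.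
Qed.

Lemma dmx_tr (a b : nat) u (A : M -> 'M[R[i]]_(a, b)) q :
  dmx u (fun q' => (A q')^T) q = (dmx u A q)^T.
Proof.
apply/matrixP => k l; rewrite !mxE.
by under eq_fun do rewrite mxE.
Qed.

Lemma cdir_tr n u (A : M -> 'M[R[i]]_n) q : mxdiff A q ->
  cdir u (fun q' => \tr (A q')) q = \tr (dmx u A q).
Proof.
move=> dA; rewrite /mxtrace cdir_sum => [|k]; last exact: dA.
by apply: eq_bigr => k _; rewrite mxE.
Qed.

Lemma dmx_contract n u (v w : 'rV[R[i]]_n) (A : M -> 'M[R[i]]_n) q :
  (v *m dmx u A q *m w^T) 0 0
  = \sum_i \sum_j \sum_k u 0 i * v 0 j * w 0 k * cpd phi i (fun q' => A q' j k) q.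
Proof.
rewrite mxE; under eq_bigr do rewrite !mxE mulr_suml.
rewrite exchange_big /= [RHS]exchange_big /=; apply: eq_bigr => j _.
rewrite [RHS]exchange_big /=; apply: eq_bigr => k _.
rewrite mxE /cdir mulr_sumr mulr_suml; apply: eq_bigr => i _; ring.
Qed.

Lemma cdir_congr (A : set M) u (h1 h2 : M -> R[i]) q : open A ->
  (forall q', A q' -> cdom phi q' -> h1 q' = h2 q') -> A q -> cdom phi q ->
  cdir u h1 q = cdir u h2 q.
Proof.
move=> oA E Aq cq; apply: eq_bigr => i _; rewrite /cpd.
by congr (_ * Complex _ _); apply: (pd_congr phi_chart oA) => // q' *; rewrite E.
Qed.

Lemma dmx_congr (A : set M) (a b : nat) u (B C : M -> 'M[R[i]]_(a, b)) q :
  open A ->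
  (forall q', A q' -> cdom phi q' -> B q' = C q') -> A q -> cdom phi q ->
  dmx u B q = dmx u C q.
Proof.
move=> oA E Aq cq; apply/matrixP => k l; rewrite !mxE.
by apply: (cdir_congr _ oA) => // q' *; rewrite E.
Qed.

Lemma cdiff_congr (A : set M) (h1 h2 : M -> R[i]) q : open A ->
  (forall q', A q' -> cdom phi q' -> h1 q' = h2 q') -> A q -> cdom phi q ->
  cdiff h1 q -> cdiff h2 q.
Proof.
move=> oA E Aq cq [d1 d2]; split=> i.
  apply: near_eq_derivable (d1 i).
  by apply: (near_chart_eq phi_chart oA) => // q' *; rewrite E.
apply: near_eq_derivable (d2 i).
by apply: (near_chart_eq phi_chart oA) => // q' *; rewrite E.
Qed.

Lemma mxdiff_congr (A : set M) (a b : nat) (B C : M -> 'M[R[i]]_(a, b)) q :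
  open A ->
  (forall q', A q' -> cdom phi q' -> B q' = C q') -> A q -> cdom phi q ->
  mxdiff B q -> mxdiff C q.
Proof.
move=> oA E Aq cq dB k l.
by apply: (cdiff_congr oA) (dB k l) => // q' *; rewrite E.
Qed.

End ComplexCalculus.

(** * The Kahler condition in a holomorphic chart *)

Section KahlerChart.
Variables (R : realType) (m : nat) (M : kahlerManifold R m).
Variable phi : chart R m M.
Hypothesis phi_atlas : atlas phi.
Implicit Types (q : M) (i j : 'I_(m + m)) (c : R[i]).
Implicit Types (u v w t : 'rV[R[i]]_(m + m)).

Local Notation J := (cmx (Jmx R m)).
Local Notation g := (fun q => cmx (metric phi q)).

Let phi_chart : is_chart phi := atlas_chart phi_atlas.

Lemma open_cdom : open (cdom phi).
Proof. by case: phi_chart. Qed.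

Lemma mxdiff_cmx (a b : nat) (A : M -> 'M[R]_(a, b)) q :
  (forall k l, rdiff phi (fun q' => A q' k l) q) ->
  mxdiff phi (fun q' => cmx (A q')) q.
Proof.
move=> dA k l; under eq_fun do rewrite mxE.
exact: (cdiff_real (dA k l)).
Qed.

Lemma cpd_cmx (a b : nat) i (A : M -> 'M[R]_(a, b)) k l q :
  cpd phi i (fun q' => cmx (A q') k l) q
  = real_complex R (pd phi i (fun q' => A q' k l) q).
Proof. by under eq_fun do rewrite mxE; exact: cpd_real. Qed.

Lemma mxdiff_metric q : cdom phi q -> mxdiff phi g q.
Proof.
move=> cq; apply: mxdiff_cmx => k l.
exact: (smooth_rdiff (metric_smooth phi_atlas k l) cq cq).
Qed.

Lemma metricC_sym q : cdom phi q -> (g q)^T = g q.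
Proof. by move=> cq; rewrite /= -cmx_tr Defs.metric_sym. Qed.

Lemma dmx_metric_sym u q : cdom phi q -> (dmx phi u g q)^T = dmx phi u g q.
Proof.
move=> cq; rewrite -dmx_tr.
apply: (dmx_congr phi_chart _ open_cdom _ cq cq) => q' _ cq'.
exact: metricC_sym.
Qed.

(** The eigenvalue is [sqrt(-1)] on vectors of type (1,0) and [- sqrt(-1)] on
    those of type (0,1). Leaving it as a parameter with square -1 lets each
    lemma also serve as its own complex conjugate. *)
Definition jeig c u := u *m J = c *: u.

(** A J-invariant bilinear form pairs two vectors of the same type to zero:
    moving J across the pairing multiplies it by the square of c. *)
Lemma jeig_iso (S : 'M[R[i]]_(m + m)) c u v :
  J *m S *m J^T = S -> c * c = -1 -> jeig c u -> jeig c v -> u *m S *m v^T = 0.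
Proof.
move=> SJ c2 uc vc.
have E : u *m S *m v^T = - (u *m S *m v^T).
  transitivity ((u *m J) *m S *m (v *m J)^T).
    by rewrite -{1}SJ trmx_mul !mulmxA.
  by rewrite uc vc linearZ /= -!scalemxAl -scalemxAr scalerA c2 scaleN1r.
have : 2%:R *: (u *m S *m v^T) = 0 by rewrite scaler_nat mulr2n {1}E addNr.
by move/eqP; rewrite scaler_eq0 pnatr_eq0 /= => /eqP.
Qed.

Lemma metric_iso c u v q : cdom phi q -> c * c = -1 -> jeig c u -> jeig c v ->
  u *m g q *m v^T = 0.
Proof.
move=> cq; apply: jeig_iso.
by rewrite /= -cmx_tr -!cmxM metric_hermitian.
Qed.

(** The components of J are constant in a holomorphic chart, so the derivatives
    of the metric are again J-invariant. *)
Lemma dmx_metric_iso c u v w q : cdom phi q -> c * c = -1 ->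
  jeig c u -> jeig c v -> u *m dmx phi w g q *m v^T = 0.
Proof.
move=> cq; apply: jeig_iso.
have dg := mxdiff_metric cq.
rewrite -(dmxMcl phi_chart w J cq dg).
rewrite -(dmxMcr phi_chart w J^T cq (mxdiffM (mxdiff_cst phi J q) dg)).
apply: (dmx_congr phi_chart _ open_cdom _ cq cq) => q' _ cq'.
by rewrite /= -cmx_tr -!cmxM metric_hermitian.
Qed.

(** The condition [metric_kahler] in terms of the metric alone: the constant
    factor J comes out of the derivatives. *)
Lemma kahler_closed u v w q : cdom phi q ->
  v *m J *m dmx phi u g q *m w^T + w *m J *m dmx phi v g q *m u^T
  + u *m J *m dmx phi w g q *m v^T = 0.
Proof.
move=> cq.
pose om := fun q' => cmx (Jmx R m *m metric phi q').
have domE x : J *m dmx phi x g q = dmx phi x om q.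
  rewrite -(dmxMcl phi_chart x J cq (mxdiff_metric cq)).
  apply: (dmx_congr phi_chart _ open_cdom _ cq cq) => q' _ cq'.
  by rewrite /om cmxM.
rewrite -![_ *m J *m _]mulmxA !domE.
apply/matrixP => a b; rewrite !ord1 mxE [X in X + _]mxE [RHS]mxE.
rewrite !dmx_contract (sum_rot (fun i j k => v 0 i * _ * _ * _)).
rewrite (sum_rot (fun i j k => w 0 i * _ * _ * _)).
rewrite (sum_rot (fun i j k => w 0 j * _ * _ * _)) -!big_split big1 //= => i _.
rewrite -!big_split big1 //= => j _; rewrite -!big_split big1 //= => k _.
rewrite !cpd_cmx.
have := congr1 (real_complex R) (metric_kahler phi_atlas cq i j k).
rewrite !rmorphD rmorph0 /= => E0.
by rewrite -[RHS](mulr0 (u 0 i * v 0 j * w 0 k)) -E0; ring.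
Qed.

(** The classical form of the Kahler condition. In [kahler_closed] one of the
    three terms pairs u with v, of equal type, and vanishes; J acts on the other
    two by opposite scalars. *)
Lemma kahler_swap c u v w q : cdom phi q -> c * c = -1 ->
  jeig c u -> jeig c v -> jeig (- c) w ->
  v *m dmx phi u g q *m w^T = u *m dmx phi v g q *m w^T.
Proof.
move=> cq c2 uc vc wc.
have := kahler_closed u v w cq.
rewrite uc vc wc -!scalemxAl (dmx_metric_iso _ cq c2 uc vc) scaler0 addr0.
rewrite scaleNr -[w *m _ *m _]trmx11 trmx_mul trmxK trmx_mul dmx_metric_sym //.
rewrite mulmxA => /eqP; rewrite subr_eq0 => /eqP; apply: scalerI.
by apply: contra_eq_neq c2 => ->; rewrite mul0r eq_sym oppr_eq0 oner_eq0.
Qed.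

Lemma dmx_addl (a b : nat) u v (A : M -> 'M[R[i]]_(a, b)) q :
  dmx phi (u + v) A q = dmx phi u A q + dmx phi v A q.
Proof.
apply/matrixP => x y; rewrite !mxE /cdir -big_split /=.
by apply: eq_bigr => i _; rewrite mxE mulrDl.
Qed.

Lemma J_sqr : J *m J = - 1%:M.
Proof.
rewrite -cmxM /Jmx mulmx_block !mul0mx !mulmx0 mul1mx mulmx1 !add0r !addr0.
have -> : block_mx (- 1%:M) 0 0 (- 1%:M) = - 1%:M :> 'M[R]_(m + m).
  by rewrite scalar_mx_block opp_block_mx !oppr0.
by rewrite /cmx map_mxN map_mx1.
Qed.

Lemma jeig_split c t : c * c = -1 ->
  exists t1 t2, [/\ t = t1 + t2, jeig c t1 & jeig (- c) t2].
Proof.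
move=> c2.
have cV : c^-1 = - c.
  have c0 : c != 0.
    by apply: contra_eq_neq c2 => ->; rewrite mul0r eq_sym oppr_eq0 oner_eq0.
  by apply: (mulfI c0); rewrite divff // mulrN c2 opprK.
have JK x : x *m J *m J = - x :> 'rV_(m + m).
  by rewrite -mulmxA J_sqr mulmxN mulmx1.
exists (2^-1 *: (t - c *: (t *m J))), (2^-1 *: (t + c *: (t *m J))); split.
- rewrite -scalerDr addrACA addNr addr0 -mulr2n -(scaler_nat 2 t) scalerA mulVf.
    by rewrite scale1r.
  by rewrite pnatr_eq0.
- rewrite /jeig -scalemxAl scalerA mulrC -scalerA; congr (_ *: _).
  by rewrite mulmxBl -scalemxAl JK scalerBr scalerA c2 scalerN scaleN1r !opprK addrC.
- rewrite /jeig -scalemxAl scalerA mulrC -scalerA; congr (_ *: _).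
  rewrite mulmxDl -scalemxAl JK scalerDr scalerA mulNr c2 opprK scale1r.
  by rewrite scalerN scaleNr addrC.
Qed.

(** Christoffel symbols with lower indices of opposite types vanish. After
    splitting t by type, one term vanishes by type and the other two cancel by
    [kahler_swap]. *)
Lemma first_kind_mixed c u w t q : cdom phi q -> c * c = -1 ->
  jeig c u -> jeig (- c) w ->
  w *m dmx phi u g q *m t^T + u *m dmx phi w g q *m t^T
  - u *m dmx phi t g q *m w^T = 0.
Proof.
move=> cq c2 uc wc.
have c2' : - c * - c = -1 by rewrite mulrNN.
have trE (x y z : 'rV_(m + m)) :
    x *m dmx phi y g q *m z^T = z *m dmx phi y g q *m x^T.
  by rewrite -[LHS]trmx11 !trmx_mul trmxK dmx_metric_sym // mulmxA.
have [t1 [t2 [-> t1c t2c]]] := jeig_split t c2.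
rewrite linearD /= !mulmxDr dmx_addl mulmxDr mulmxDl.
rewrite (dmx_metric_iso u cq c2' wc t2c) (dmx_metric_iso w cq c2 uc t1c).
rewrite add0r addr0 (trE w) (kahler_swap cq c2 uc t1c wc).
rewrite (trE u w) (trE u t2) (kahler_swap cq c2' wc t2c) ?opprK //.
by rewrite subrr.
Qed.

End KahlerChart.

(** * The Levi-Civita connection in mixed directions *)

Section KahlerConnection.
Variables (R : realType) (m : nat) (M : kahlerManifold R m).
Variable phi : chart R m M.
Hypothesis phi_atlas : atlas phi.
Implicit Types (q : M) (i j : 'I_(m + m)) (c : R[i]).
Implicit Types (u v w t : 'rV[R[i]]_(m + m)).

Local Notation J := (cmx (Jmx R m)).
Local Notation g := (fun q => cmx (metric phi q)).
Let phi_chart : is_chart phi := atlas_chart phi_atlas.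

Lemma metric_unit q : cdom phi q -> metric phi q \in unitmx.
Proof.
move=> cq; rewrite unitmxE unitfE; apply/negP => /det0P [v v0 vg].
by have := metric_pos phi_atlas cq v0; rewrite vg mul0mx mxE ltxx.
Qed.

Lemma cmx_inv_tr q : cdom phi q -> (invmx (metric phi q))^T = invmx (metric phi q).
Proof. by move=> cq; rewrite trmx_inv Defs.metric_sym. Qed.

(** Twice the Christoffel symbol of the first kind, with l the lowered index. *)
Definition first_kind q (i j l : 'I_(m + m)) : R :=
  pd phi i (fun q' => metric phi q' j l) q
  + pd phi j (fun q' => metric phi q' i l) q
  - pd phi l (fun q' => metric phi q' i j) q.

Lemma first_kind_contract u w t q :
  \sum_i \sum_j \sum_l u 0 i * w 0 j * t 0 l * real_complex R (first_kind q i j l)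
  = (w *m dmx phi u g q *m t^T) 0 0 + (u *m dmx phi w g q *m t^T) 0 0
    - (u *m dmx phi t g q *m w^T) 0 0.
Proof.
rewrite !dmx_contract.
rewrite [X in _ + X - _]exchange_big /=.
rewrite [X in _ - X](sum_rot (fun i j k => t 0 i * u 0 j * w 0 k * _)).
rewrite [X in _ - X](sum_rot (fun i j k => t 0 j * u 0 k * w 0 i * _)).
rewrite -sumrN -!big_split /=; apply: eq_bigr => i _.
rewrite -sumrN -!big_split /=; apply: eq_bigr => j _.
rewrite -sumrN -!big_split /=; apply: eq_bigr => l _.
by rewrite !cpd_cmx /first_kind rmorphB rmorphD /=; ring.
Qed.

Lemma first_kind_mixed_sum c u w t q : cdom phi q -> c * c = -1 ->
  jeig c u -> jeig (- c) w ->
  \sum_i \sum_j \sum_l u 0 i * w 0 j * t 0 l * real_complex R (first_kind q i j l)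
  = 0.
Proof.
move=> cq c2 uc wc; rewrite first_kind_contract.
have D (A B C : 'M[R[i]]_1) : A 0 0 + B 0 0 - C 0 0 = (A + B - C) 0 0.
  by rewrite !mxE.
by rewrite D (first_kind_mixed phi_atlas t cq c2 uc wc) mxE.
Qed.

Definition coord_hess (f : M -> R) q : 'M[R]_(m + m) :=
  \matrix_(i, j) pd phi i (pd phi j f) q.

Definition coord_diff (f : M -> R) q : 'rV[R]_(m + m) := \row_i pd phi i f q.

(** On mixed arguments the Hessian is the matrix of plain second derivatives,
    by the vanishing of the mixed Christoffel symbols. *)
Lemma hessian_mixed (f : M -> R) c u w q : cdom phi q -> c * c = -1 ->
  jeig c u -> jeig (- c) w ->
  cbil (hessian f phi q) u w = (u *m cmx (coord_hess f q) *m w^T) 0 0.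
Proof.
move=> cq c2 uc wc; rewrite /cbil.
(* t is half the gradient: contracting the Christoffel symbols with df is
   pairing the first-kind symbols with it. *)
pose t := 2^-1 *: (coord_diff f q *m invmx (metric phi q)).
pose K := \matrix_(i, j) \sum_l t 0 l * first_kind q i j l.
have -> : hessian f phi q = coord_hess f q - K.
  apply/matrixP => i j; rewrite !mxE; congr (_ - _).
  under eq_bigr do rewrite /christoffel mulrC mulr_sumr mulr_sumr.
  rewrite exchange_big /=; apply: eq_bigr => l _.
  rewrite !mxE mulr_sumr mulr_suml; apply: eq_bigr => k _.
  by rewrite !mxE /first_kind; ring.
rewrite /cmx map_mxB mulmxBr mulmxBl mxE [X in _ + X]mxE.
suff -> : (u *m map_mx (real_complex R) K *m w^T) 0 0 = 0 by exact: subr0.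
rewrite -[RHS](first_kind_mixed_sum (cmx t) cq c2 uc wc) mxE; under eq_bigr do rewrite mxE mulr_suml.
rewrite exchange_big /=; apply: eq_bigr => i _; apply: eq_bigr => j _.
rewrite !mxE rmorph_sum mulr_sumr mulr_suml; apply: eq_bigr => l _.
by rewrite rmorphM /= !mxE; ring.
Qed.

Lemma christoffel_lower q i j (l : 'I_(m + m)) : cdom phi q ->
  \sum_k christoffel phi q i j k * metric phi q k l = 2^-1 * first_kind q i j l.
Proof.
move=> cq.
pose r := \row_l0 first_kind q i j l0.
have -> : \sum_k christoffel phi q i j k * metric phi q k l
    = 2^-1 * (r *m invmx (metric phi q) *m metric phi q) 0 l.
  rewrite mxE mulr_sumr; apply: eq_bigr => k _.
  rewrite mulrA; congr (_ * _); rewrite /christoffel; congr (_ * _).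
  rewrite -[in RHS]cmx_inv_tr // mxE; apply: eq_bigr => l0 _.
  by rewrite !mxE mulrC.
by rewrite mulmxKV ?metric_unit // mxE.
Qed.

(** Lowering the index of Y turns its covariant derivative into a plain
    derivative when tested in mixed directions. This is the vanishing of the
    mixed Christoffel symbols, now for the dual connection on 1-forms, and it
    makes the divergence computable without any Christoffel symbol. *)
Lemma nabla_mixed c u w (Y : cvfield R m M) q : cdom phi q -> c * c = -1 ->
  jeig c u -> jeig (- c) w -> mxdiff phi (Y phi) q ->
  cbil (metric phi q) (nabla u Y phi q) w
  = (dmx phi u (fun q' => Y phi q' *m g q') q *m w^T) 0 0.
Proof.
move=> cq c2 uc wc dY; rewrite /cbil.
set y := Y phi q.
pose N := \row_k \sum_i \sum_j u 0 i * y 0 j * real_complex R (christoffel phi q i j k).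
have -> : nabla u Y phi q = dmx phi u (Y phi) q + N.
  apply/rowP => k; rewrite !mxE -big_split /=; apply: eq_bigr => i _.
  rewrite mulrDr; congr (_ + _); rewrite mulr_sumr; apply: eq_bigr => j _.
  by ring.
rewrite (dmxM phi_chart u cq dY (mxdiff_metric phi_atlas cq)).
rewrite !mulmxDl mxE [RHS]mxE; congr (_ + _).
have Z := first_kind_mixed_sum y cq c2 uc wc; rewrite first_kind_contract in Z.
have E := first_kind_contract u y w q.
have T : w *m dmx phi u g q *m y^T = y *m dmx phi u g q *m w^T.
  by rewrite -[LHS]trmx11 !trmx_mul trmxK dmx_metric_sym // mulmxA.
have -> : (N *m cmx (metric phi q) *m w^T) 0 0 = 2^-1 *
  \sum_i \sum_j \sum_l u 0 i * y 0 j * w 0 l * real_complex R (first_kind q i j l).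
  rewrite mxE; under eq_bigr do rewrite mxE mulr_suml.
  rewrite mulr_sumr.
  transitivity (\sum_l \sum_i \sum_j 2^-1 * (u 0 i * y 0 j * w 0 l
      * real_complex R (first_kind q i j l))); last first.
    rewrite exchange_big /=; apply: eq_bigr => i _.
    rewrite exchange_big mulr_sumr /=; apply: eq_bigr => j _.
    by rewrite mulr_sumr.
  apply: eq_bigr => l _.
  under eq_bigr do rewrite mxE !mulr_suml.
  rewrite exchange_big /=; apply: eq_bigr => i _.
  under eq_bigr do rewrite !mulr_suml.
  rewrite exchange_big /=; apply: eq_bigr => j _.
  have := congr1 (real_complex R) (christoffel_lower i j l cq).
  rewrite rmorphM fmorphV rmorph_nat rmorph_sum /= => H.
  transitivity (u 0 i * y 0 j * w 0 l * (2^-1 * real_complex R (first_kind q i j l)));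
    last by ring.
  rewrite -H mulr_sumr; apply: eq_bigr => k _.
  rewrite [in LHS]mxE [w^T _ _]mxE.
  rewrite (rmorphM (real_complex R) (christoffel phi q i j k) (metric phi q k l)) /=.
  by ring.
rewrite E; move: Z; rewrite T /=.
set a := (y *m _ *m _) 0 0; set b := (u *m dmx phi w _ _ *m _) 0 0.
set d := (u *m dmx phi y _ _ *m _) 0 0 => Z.
have -> : a + d - b = 2 * a - (a + b - d) by ring.
by rewrite Z subr0 mulrA mulVf ?mul1r // pnatr_eq0.
Qed.

End KahlerConnection.

(** * Unitary frames *)

Section UnitaryFrame.
Variables (R : realType) (m : nat) (M : kahlerManifold R m).
Variable phi : chart R m M.
Hypothesis phi_atlas : atlas phi.
Variables (U : set M) (e : 'I_m -> cvfield R m M).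
Hypothesis U_open : open U.
Hypothesis e_unitary : unitary_frame U e.
Implicit Types (q : M) (a b : 'I_m) (u v w : 'rV[R[i]]_(m + m)).

Local Notation J := (cmx (Jmx R m)).
Local Notation g := (fun q => cmx (metric phi q)).
Let phi_chart : is_chart phi := atlas_chart phi_atlas.

Definition frame_mx q : 'M[R[i]]_(m, m + m) := \matrix_a e a phi q.
Definition conj_frame_mx q : 'M[R[i]]_(m, m + m) := map_mx (@conjc R) (frame_mx q).

Local Notation E := frame_mx.
Local Notation Ec := conj_frame_mx.

Lemma row_frame a q : row a (E q) = e a phi q.
Proof. exact: rowK. Qed.

Lemma row_conj_frame a q : row a (Ec q) = conj_vec (e a phi q).
Proof. by rewrite /conj_frame_mx -map_row row_frame. Qed.

Lemma frame_entry (X : 'M[R[i]]_(m + m)) a b q :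
  (E q *m X *m (Ec q)^T) a b
  = (e a phi q *m X *m (conj_vec (e b phi q))^T) 0 0.
Proof.
rewrite -row_frame -row_conj_frame -row_mul tr_row.
by rewrite mxE [RHS]mxE; apply: eq_bigr => k _; rewrite !mxE.
Qed.

Section AtPoint.
Variable q : M.
Hypotheses (Uq : U q) (cq : cdom phi q).

Lemma frame_jeig a : jeig 'i%C (e a phi q).
Proof. exact: (e_unitary.2 phi q phi_atlas Uq cq).1. Qed.

Lemma conj_frame_jeig a : jeig (- 'i%C) (conj_vec (e a phi q)).
Proof.
rewrite /jeig /conj_vec -[J]conj_cmx -map_mxM frame_jeig map_mxZ.
by congr (_ *: _); apply/eqP; rewrite eq_complex /= oppr0 !eqxx.
Qed.

Lemma frame_J : E q *m J = 'i%C *: E q.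
Proof.
by apply/row_matrixP => a; rewrite row_mul linearZ /= row_frame frame_jeig.
Qed.

Lemma conj_frame_J : Ec q *m J = - 'i%C *: Ec q.
Proof.
apply/row_matrixP => a.
by rewrite row_mul linearZ /= row_conj_frame conj_frame_jeig.
Qed.

Lemma frame_unitary : E q *m g q *m (Ec q)^T = 1%:M.
Proof.
apply/matrixP => a b; rewrite frame_entry [RHS]mxE.
exact: (e_unitary.2 phi q phi_atlas Uq cq).2.
Qed.

Lemma frame_isotropic : E q *m g q *m (E q)^T = 0.
Proof.
apply/matrixP => a b.
have iso := metric_iso phi_atlas cq (sqr_ii R) (frame_jeig a) (frame_jeig b).
transitivity ((e a phi q *m g q *m (e b phi q)^T) 0 0); last by rewrite iso !mxE.
rewrite -!row_frame -row_mul tr_row.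
by rewrite mxE [RHS]mxE; apply: eq_bigr => k _; rewrite !mxE.
Qed.

Lemma conj_frame_unitary : Ec q *m g q *m (E q)^T = 1%:M.
Proof.
have := congr1 trmx frame_unitary.
by rewrite !trmx_mul trmxK (metricC_sym phi_atlas cq) mulmxA trmx1.
Qed.

Lemma conj_frame_isotropic : Ec q *m g q *m (Ec q)^T = 0.
Proof.
have := congr1 (map_mx (@conjc R)) frame_isotropic.
by rewrite !map_mxM map_trmx /= conj_cmx map_mx0.
Qed.

End AtPoint.

(** The part of type (0,1) x (1,0) of the inverse metric. Expressing everything
    through it removes the frame from the computation: only its smoothness in
    the coordinates and its algebraic relations with the metric remain. *)
Definition frame_dual q : 'M[R[i]]_(m + m) := (Ec q)^T *m E q.
Local Notation G := frame_dual.

Lemma frame_dual_trace (X : 'M[R[i]]_(m + m)) q :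
  \tr (X *m G q) = \sum_a (e a phi q *m X *m (conj_vec (e a phi q))^T) 0 0.
Proof.
rewrite mulmxA mxtrace_mulC mulmxA; apply: eq_bigr => a _.
exact: frame_entry.
Qed.

(** The frame and its conjugate together form a basis, dual to itself up to
    the exchange of the two halves; a one-sided inverse of a square matrix is
    two-sided. *)
Lemma frame_complete q : U q -> cdom phi q ->
  G q + (G q)^T = cmx (invmx (metric phi q)).
Proof.
move=> Uq cq.
pose F := col_mx (E q) (Ec q); pose Fc := col_mx (Ec q) (E q).
have FF : F *m g q *m Fc^T = 1%:M.
  rewrite /F /Fc tr_col_mx mul_col_mx mul_col_row frame_unitary //.
  by rewrite frame_isotropic // conj_frame_isotropic // conj_frame_unitary //
     -scalar_mx_block.
have FG : Fc^T *m F *m g q = 1%:M by rewrite -mulmxA; apply: mulmx1C.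
have FE : Fc^T *m F = G q + (G q)^T.
  by rewrite /F /Fc tr_col_mx mul_row_col /frame_dual trmx_mul trmxK.
rewrite -FE -[LHS]mulmx1 -[1%:M](map_mx1 (real_complex R)).
by rewrite -(mulmxV (metric_unit phi_atlas cq)) map_mxM mulmxA FG mul1mx.
Qed.

(** For a covector written as a row x, [x *m proj01] is its (0,1) part. *)
Definition proj01 : 'M[R[i]]_(m + m) := 2^-1 *: (1%:M + 'i%C *: J^T).

(** Although the frame varies, this product is constant: [frame_complete]
    determines it from J, since J^T acts by opposite scalars on [G] and on its
    transpose. *)
Lemma frame_dual_metric q : U q -> cdom phi q -> G q *m g q = proj01.
Proof.
move=> Uq cq.
have gE : (G q + (G q)^T) *m g q = 1%:M.
  by rewrite frame_complete // /= -cmxM mulVmx ?metric_unit // /cmx map_mx1.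
have JG : J^T *m G q = - 'i%C *: G q.
  by rewrite /frame_dual mulmxA -trmx_mul conj_frame_J // linearZ /= -scalemxAl.
have JGt : J^T *m (G q)^T = 'i%C *: (G q)^T.
  by rewrite /frame_dual trmx_mul trmxK mulmxA -trmx_mul frame_J // linearZ /= -scalemxAl.
have two : (2 : R[i]) != 0 by rewrite pnatr_eq0.
apply: (scalerI two); rewrite /proj01 scalerA divff // scale1r.
rewrite -[J^T]mulmx1 -gE mulmxA mulmxDr JG JGt mulmxDl -!scalemxAl.
rewrite scalerDr !scalerA mulrN sqr_ii opprK scale1r scaleN1r.
by rewrite mulmxDl addrACA subrr addr0 scaler_nat mulr2n.
Qed.

Lemma metric_frame_dual q : U q -> cdom phi q -> g q *m G q = 1%:M - proj01^T.
Proof.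
move=> Uq cq.
have gE : (G q + (G q)^T) *m g q = 1%:M.
  by rewrite frame_complete // /= -cmxM mulVmx ?metric_unit // /cmx map_mx1.
rewrite -(frame_dual_metric Uq cq) -[X in X - _]trmx1 -gE mulmxDl linearD /=.
by rewrite addrAC subrr add0r trmx_mul trmxK (metricC_sym phi_atlas cq).
Qed.

Lemma frame_dualK q : U q -> cdom phi q -> G q *m g q *m G q = G q.
Proof.
move=> Uq cq; rewrite /frame_dual -!mulmxA [E q *m (_ *m _)]mulmxA.
by rewrite [E q *m _ *m (_ *m _)]mulmxA frame_unitary // mul1mx.
Qed.

Lemma mxdiff_frame q : U q -> cdom phi q -> mxdiff phi E q.
Proof.
move=> Uq cq a k; under eq_fun do rewrite mxE.
have [dR dI] := (e_unitary.1 a).2 phi k phi_atlas.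
by split; [exact: (smooth_rdiff dR Uq cq) | exact: (smooth_rdiff dI Uq cq)].
Qed.

Lemma mxdiff_conj_frame q : U q -> cdom phi q -> mxdiff phi Ec q.
Proof.
move=> Uq cq a k; under eq_fun do rewrite mxE.
exact: (cdiff_conj (mxdiff_frame Uq cq a k)).
Qed.

Lemma mxdiff_frame_dual q : U q -> cdom phi q -> mxdiff phi G q.
Proof.
move=> Uq cq; apply: mxdiffM; last exact: mxdiff_frame.
exact: (mxdiff_tr (mxdiff_conj_frame Uq cq)).
Qed.

(** Differentiate [G = G g G]. As the projectors [G g] and [g G] are constant,
    two of the three terms of the Leibniz rule are equal to the derivative of G
    itself. *)
Lemma dmx_frame_dual u q : U q -> cdom phi q ->
  dmx phi u G q = - (G q *m dmx phi u g q *m G q).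
Proof.
move=> Uq cq.
have dG := mxdiff_frame_dual Uq cq; have dg := mxdiff_metric phi_atlas cq.
have E1 : dmx phi u G q = proj01 *m dmx phi u G q.
  rewrite -(dmxMcl phi_chart u proj01 cq dG).
  apply: (dmx_congr phi_chart _ U_open _ Uq cq) => q' Uq' cq'.
  by rewrite -(frame_dual_metric Uq' cq') frame_dualK.
have E2 : dmx phi u G q = dmx phi u G q *m (g q *m G q).
  rewrite (metric_frame_dual Uq cq) -(dmxMcr phi_chart u _ cq dG).
  apply: (dmx_congr phi_chart _ U_open _ Uq cq) => q' Uq' cq'.
  by rewrite -(metric_frame_dual Uq' cq') mulmxA frame_dualK.
have E3 : dmx phi u G q = dmx phi u (fun q' => G q' *m g q' *m G q') q.
  apply: (dmx_congr phi_chart _ U_open _ Uq cq) => q' Uq' cq'.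
  by rewrite frame_dualK.
have := E3.
rewrite (dmxM phi_chart u cq (mxdiffM dG dg) dG) (dmxM phi_chart u cq dG dg).
rewrite mulmxDl -mulmxA -E2 frame_dual_metric // -E1 => /eqP.
rewrite -addrA -subr_eq0 opprD addrA subrr add0r oppr_eq0 addrC => /eqP E4.
by apply/eqP; rewrite -addr_eq0; apply/eqP.
Qed.

(** [kahler_swap] with the (0,1) argument running through the conjugate frame. *)
Lemma frame_dual_swap u v q : U q -> cdom phi q ->
  jeig 'i%C u -> jeig 'i%C v ->
  v *m dmx phi u g q *m G q = u *m dmx phi v g q *m G q.
Proof.
move=> Uq cq ui vi; rewrite /frame_dual !mulmxA.
suff -> : v *m dmx phi u g q *m (Ec q)^T = u *m dmx phi v g q *m (Ec q)^T by [].
apply/matrixP => x b; rewrite ord1.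
have colE y : (y *m (Ec q)^T) 0 b = (y *m (conj_vec (e b phi q))^T) 0 0.
  rewrite -row_conj_frame tr_row mxE [RHS]mxE.
  by apply: eq_bigr => k _; rewrite !mxE.
by rewrite !colE (kahler_swap phi_atlas cq (sqr_ii R) ui vi (conj_frame_jeig Uq cq b)).
Qed.

End UnitaryFrame.

(** * The complex Hessian and two divergences *)

Section FrameHessian.
Variables (R : realType) (m : nat) (M : kahlerManifold R m).
Variable phi : chart R m M.
Hypothesis phi_atlas : atlas phi.
Variables (U : set M) (e : 'I_m -> cvfield R m M).
Hypothesis U_open : open U.
Hypothesis e_unitary : unitary_frame U e.
Variable f : M -> R.
Hypothesis f_smooth : smooth_fun f.
Implicit Types (q : M) (a b : 'I_m) (u v w : 'rV[R[i]]_(m + m)).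

Local Notation J := (cmx (Jmx R m)).
Local Notation g := (fun q => cmx (metric phi q)).
Local Notation E := (frame_mx phi e).
Local Notation Ec := (conj_frame_mx phi e).
Local Notation G := (frame_dual phi e).
Local Notation df := (fun q => cmx (coord_diff phi f q)).
Local Notation H := (fun q => cmx (coord_hess phi f q)).
Local Notation P := (proj01 R m).
Let phi_chart : is_chart phi := atlas_chart phi_atlas.
Let cdom_open : open (cdom phi) := open_cdom phi_atlas.
Let f_in : smooth_in phi (cdom phi) f := f_smooth phi_atlas.

Lemma mxdiff_coord_diff q : cdom phi q -> mxdiff phi df q.
Proof.
move=> cq; apply: mxdiff_cmx => k l; under eq_fun do rewrite mxE.
exact: (smooth_rdiff (smooth_in_pd phi_chart cdom_open l f_in) cq cq).
Qed.

Lemma mxdiff_coord_hess q : cdom phi q -> mxdiff phi H q.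
Proof.
move=> cq; apply: mxdiff_cmx => k l; under eq_fun do rewrite mxE.
have s1 := smooth_in_pd phi_chart cdom_open l f_in.
exact: (smooth_rdiff (smooth_in_pd phi_chart cdom_open k s1) cq cq).
Qed.

Lemma coord_hess_sym q : cdom phi q -> (H q)^T = H q.
Proof.
move=> cq; apply/matrixP => i j; rewrite !mxE.
by rewrite (pd_comm phi_chart cdom_open i j f_in cq cq).
Qed.

Lemma dmx_coord_diff u q : dmx phi u df q = u *m H q.
Proof.
apply/rowP => l; rewrite !mxE; apply: eq_bigr => i _.
rewrite cpd_cmx !mxE; congr (_ * real_complex R (pd phi i _ q)).
by apply/funext => q'; rewrite mxE.
Qed.

(** The identity [f_{a bbar c} = f_{c bbar a}] for covariant third derivatives
    reduces to the symmetry of plain third derivatives of f. *)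
Lemma dmx_coord_hess_swap u v q : cdom phi q ->
  v *m dmx phi u H q = u *m dmx phi v H q.
Proof.
move=> cq; apply/rowP => l; rewrite !mxE.
under eq_bigr do rewrite mxE mulr_sumr.
under [RHS]eq_bigr do rewrite mxE mulr_sumr.
rewrite exchange_big /=; apply: eq_bigr => i _; apply: eq_bigr => j _.
rewrite !cpd_cmx mulrCA; congr (_ * (_ * real_complex R _)).
under eq_fun do rewrite mxE; under [in RHS]eq_fun do rewrite mxE.
have s1 := smooth_in_pd phi_chart cdom_open l f_in.
exact: (pd_comm phi_chart cdom_open i j s1 cq cq).
Qed.

Lemma fbarE a q : fbar f e a phi q = (df q *m (Ec q)^T) 0 a.
Proof. by rewrite mxE; apply: eq_bigr => i _; rewrite !mxE mulrC. Qed.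

(** The complex Hessian in the frame, free of Christoffel symbols. *)
Lemma chessE a b q : U q -> cdom phi q ->
  chess f e a b phi q = (E q *m H q *m (Ec q)^T) a b.
Proof.
move=> Uq cq; rewrite frame_entry.
exact: (hessian_mixed phi_atlas f cq (sqr_ii R) (frame_jeig phi_atlas e_unitary Uq cq a)
         (conj_frame_jeig phi_atlas e_unitary Uq cq b)).
Qed.

Lemma conj_chess a b q : U q -> cdom phi q ->
  conjc (chess f e a b phi q) = chess f e b a phi q.
Proof.
move=> Uq cq; rewrite !chessE //.
transitivity ((map_mx (@conjc R) (E q *m H q *m (Ec q)^T)) a b); first by rewrite [RHS]mxE.
have EcK : map_mx (@conjc R) (Ec q) = E q := conjc_mxK _.
rewrite !map_mxM -map_trmx /= conj_cmx EcK -/(Ec q).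
transitivity ((E q *m H q *m (Ec q)^T)^T a b); last by rewrite [LHS]mxE.
by rewrite !trmx_mul trmxK coord_hess_sym // mulmxA.
Qed.

Lemma laplaceE q : U q -> cdom phi q ->
  \sum_a chess f e a a phi q = \tr (H q *m G q).
Proof.
move=> Uq cq; rewrite mulmxA mxtrace_mulC mulmxA; apply: eq_bigr => a _.
exact: chessE.
Qed.

Lemma norm_chessE q : U q -> cdom phi q ->
  \sum_a \sum_b `|chess f e a b phi q| ^+ 2 = \tr (H q *m G q *m H q *m G q).
Proof.
move=> Uq cq.
have -> : \tr (H q *m G q *m H q *m G q)
    = \tr ((E q *m H q *m (Ec q)^T) *m (E q *m H q *m (Ec q)^T)).
  by rewrite /frame_dual !mulmxA mxtrace_mulC !mulmxA.
apply: eq_bigr => a _; rewrite mxE; apply: eq_bigr => b _.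
by rewrite sqr_normc conj_chess // !chessE.
Qed.

Definition grad10 q : 'rV[R[i]]_(m + m) := df q *m G q.
Local Notation V := grad10.

Lemma grad10_jeig q : U q -> cdom phi q -> jeig 'i%C (V q).
Proof.
move=> Uq cq; rewrite /jeig /grad10 /frame_dual !mulmxA -[_ *m E q *m _]mulmxA.
by rewrite (frame_J phi_atlas e_unitary Uq cq) -scalemxAr.
Qed.

Lemma grad10_sum q : V q = \sum_a fbar f e a phi q *: e a phi q.
Proof.
rewrite /grad10 /frame_dual mulmxA mulmx_sum_row; apply: eq_bigr => a _.
by rewrite fbarE row_frame.
Qed.

Lemma proj01_conj_frame b q : U q -> cdom phi q ->
  P *m (conj_vec (e b phi q))^T = (conj_vec (e b phi q))^T.
Proof.
move=> Uq cq; rewrite /proj01 -scalemxAl mulmxDl mul1mx -scalemxAl -trmx_mul.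
rewrite (conj_frame_jeig phi_atlas e_unitary Uq cq b) linearZ /= scalerA.
by rewrite mulrN sqr_ii opprK scale1r -mulr2n -(scaler_nat 2 (_^T)) scalerA mulVf ?scale1r //.
Qed.

(** The left side is the divergence of the (1,0) field dual to the form
    [f_{bbar} f_{b cbar}], written as in [nabla_mixed]. By the Leibniz rule it
    is the squared norm of the complex Hessian, from differentiating the
    gradient, plus the derivative of the Laplacian along the (1,0) part of the
    gradient, from differentiating the Hessian. The derivatives of the metric
    that enter through both cancel by [trace_rearrange]. *)
Lemma hessian_grad_div q : U q -> cdom phi q ->
  \sum_b (dmx phi (e b phi q) (fun q' => V q' *m H q' *m P) q
          *m (conj_vec (e b phi q))^T) 0 0
  = \tr (H q *m G q *m H q *m G q)
    + cdir phi (V q) (fun q' => \tr (H q' *m G q')) q.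
Proof.
move=> Uq cq.
have ddf := mxdiff_coord_diff cq; have dH := mxdiff_coord_hess cq.
have dG := mxdiff_frame_dual phi_atlas e_unitary Uq cq.
have dV : mxdiff phi V q := mxdiffM ddf dG.
(* X gathers the three Leibniz terms, with the frame vector e_b factored out on
   the left by the two swap lemmas. *)
pose X := H q *m G q *m H q - dmx phi (V q) g q *m G q *m H q + dmx phi (V q) H q.
transitivity (\tr (X *m G q)).
  rewrite frame_dual_trace; apply: eq_bigr => b _.
  rewrite (dmxMcr phi_chart _ P cq (mxdiffM dV dH)) -mulmxA proj01_conj_frame //.
  have -> // : dmx phi (e b phi q) (fun q' => V q' *m H q') q = e b phi q *m X.
  have eb := frame_jeig phi_atlas e_unitary Uq cq b.
  have dVE : dmx phi (e b phi q) V q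
      = e b phi q *m H q *m G q - e b phi q *m dmx phi (V q) g q *m G q.
    rewrite (dmxM phi_chart _ cq ddf dG) dmx_coord_diff.
    rewrite (dmx_frame_dual phi_atlas U_open e_unitary _ Uq cq) mulmxN.
    rewrite -(frame_dual_swap phi_atlas e_unitary Uq cq eb (grad10_jeig Uq cq)).
    by rewrite /grad10 !mulmxA.
  rewrite (dmxM phi_chart _ cq dV dH) dVE dmx_coord_hess_swap //.
  by rewrite /X mulmxDr mulmxBr mulmxBl !mulmxA.
rewrite (cdir_tr _ (mxdiffM dH dG)) (dmxM phi_chart _ cq dH dG).
rewrite (dmx_frame_dual phi_atlas U_open e_unitary _ Uq cq).
exact: trace_rearrange.
Qed.

(** As in [hessian_grad_div], the left side is a divergence computed from the
    dual 1-form, here that of s V. *)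
Lemma scaled_grad_div (s : M -> R[i]) q : U q -> cdom phi q -> cdiff phi s q ->
  \sum_b (dmx phi (e b phi q) (fun q' => s q' *: (df q' *m P)) q
          *m (conj_vec (e b phi q))^T) 0 0
  = cdir phi (V q) s q + s q * \tr (H q *m G q).
Proof.
move=> Uq cq ds; have ddf := mxdiff_coord_diff cq.
have dfP : mxdiff phi (fun q' => df q' *m P) q.
  exact: (mxdiffM ddf (mxdiff_cst phi P q)).
rewrite grad10_sum cdir_suml frame_dual_trace mulr_sumr -big_split /=.
apply: eq_bigr => b _.
rewrite (dmxZ phi_chart _ cq ds dfP) (dmxMcr phi_chart _ P cq ddf) dmx_coord_diff.
rewrite mulmxDl -!scalemxAl -!mulmxA proj01_conj_frame // !mulmxA.
rewrite mxE [X in X + _]mxE [X in _ + X]mxE; congr (_ + _).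
rewrite mulrC fbarE -row_conj_frame tr_row; congr (_ * _).
by rewrite mxE [RHS]mxE; apply: eq_bigr => k _; rewrite !mxE.
Qed.

End FrameHessian.

(** * The identity for a frame adapted to the gradient *)

Section MainIdentity.
Variables (R : realType) (m : nat) (M : kahlerManifold R m).
Variable phi : chart R m M.
Hypothesis phi_atlas : atlas phi.
Variables (U : set M) (e : 'I_m -> cvfield R m M).
Hypothesis U_open : open U.
Hypothesis e_unitary : unitary_frame U e.
Variable f : M -> R.
Hypothesis f_smooth : smooth_fun f.
Variable a1 : 'I_m.
Hypothesis e_grad : forall q, U q -> cdom phi q ->
  e a1 phi q = grad_frame_vector f phi q.
Implicit Types (q : M) (a b : 'I_m).

Local Notation J := (cmx (Jmx R m)).
Local Notation g := (fun q => cmx (metric phi q)).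
Local Notation E := (frame_mx phi e).
Local Notation Ec := (conj_frame_mx phi e).
Local Notation G := (frame_dual phi e).
Local Notation df := (fun q => cmx (coord_diff phi f q)).
Local Notation H := (fun q => cmx (coord_hess phi f q)).
Local Notation V := (grad10 phi e f).
Local Notation P := (proj01 R m).
Local Notation F := (fun a b q => chess f e a b phi q).
Let phi_chart : is_chart phi := atlas_chart phi_atlas.

Lemma metric_conj_frame_J a q : U q -> cdom phi q ->
  J *m (g q *m (conj_vec (e a phi q))^T) = 'i%C *: (g q *m (conj_vec (e a phi q))^T).
Proof.
move=> Uq cq.
have gJ : J *m g q *m J^T = g q.
  by rewrite /= -cmx_tr -!cmxM metric_hermitian.
rewrite -[in RHS]gJ -!mulmxA -trmx_mul.
rewrite (conj_frame_jeig phi_atlas e_unitary Uq cq a) linearZ /= -!scalemxAr.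
by rewrite scalerA mulrN sqr_ii opprK scale1r.
Qed.

(** For real x, the vector [x - sqrt(-1) J x] is twice the (1,0) part of x, and
    pairing with a (0,1) vector does not see the remaining (0,1) part. *)
Lemma pair_conj_frame (k : R[i]) (x : 'rV_(m + m)) a q : U q -> cdom phi q ->
  (k *: (x - 'i%C *: (x *m J))) *m g q *m (conj_vec (e a phi q))^T
  = k *: (2 *: (x *m g q *m (conj_vec (e a phi q))^T)).
Proof.
move=> Uq cq; rewrite -!scalemxAl; congr (_ *: _).
rewrite -[LHS]mulmxA mulmxBl -scalemxAl -[x *m J *m _]mulmxA metric_conj_frame_J //.
by rewrite -scalemxAr scalerA sqr_ii scaleN1r opprK -mulr2n mulmxA scaler_nat.
Qed.

(** Up to the factor k, the numbers [f_{abar}] are the products of e_1 with the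
    conjugate frame. The factor is nonzero because e_1 has norm one, so the
    gradient vanishes nowhere on U. *)
Lemma fbar_eq0 a q : U q -> cdom phi q -> a != a1 -> fbar f e a phi q = 0.
Proof.
move=> Uq cq aN.
pose k := (real_complex R (Num.sqrt 2))^-1 * real_complex R (norm_grad f phi q)^-1.
have fE b : (e a1 phi q *m g q *m (conj_vec (e b phi q))^T) 0 0
    = k * (2 * fbar f e b phi q).
  have -> : e a1 phi q
      = k *: (cmx (grad f phi q) - 'i%C *: (cmx (grad f phi q) *m J)).
    have nE : cmx ((norm_grad f phi q)^-1 *: grad f phi q)
        = real_complex R (norm_grad f phi q)^-1 *: cmx (grad f phi q).
      exact: map_mxZ.
    rewrite (e_grad Uq cq) /grad_frame_vector /k -[in RHS]scalerA.
    rewrite (cmxM (_ *: _)) nE [in RHS]scalerBr -[_ *: _ *m J]scalemxAl.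
    by rewrite [in LHS]scalerA ['i%C * _]mulrC -[in LHS]scalerA.
  rewrite pair_conj_frame // mxE; congr (k * _); rewrite mxE; congr (2 * _).
  have -> : cmx (grad f phi q) *m g q = df q.
    by rewrite /= -cmxM /grad mulmxKV ?metric_unit.
  rewrite fbarE -row_conj_frame tr_row.
  by rewrite mxE [RHS]mxE; apply: eq_bigr => l _; rewrite !mxE.
have uE b := (e_unitary.2 phi q phi_atlas Uq cq).2 a1 b.
have kN0 : k != 0.
  apply/eqP => k0; have := uE a1; rewrite /cbil fE k0 mul0r eqxx => /esym/eqP.
  by rewrite oner_eq0.
have := uE a; rewrite /cbil fE eq_sym (negbTE aN) => /eqP.
by rewrite mulf_eq0 (negbTE kN0) /= mulf_eq0 pnatr_eq0 /= => /eqP.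
Qed.

Lemma grad10_first q : U q -> cdom phi q -> V q = fbar f e a1 phi q *: e a1 phi q.
Proof.
move=> Uq cq; rewrite grad10_sum (bigD1 a1) //= big1 ?addr0 // => a aN.
by rewrite fbar_eq0 // scale0r.
Qed.

Definition tangential_field : cvfield R m M := fun phi q =>
  \sum_(c | c != a1) \sum_a
    (fbar f e a phi q * chess f e a c phi q) *: e c phi q.
Local Notation Y := tangential_field.

(** Extending the outer sum over c to all indices adds only the term c = 1,
    which is [f_{1 1bar}] times the (1,0) part of the gradient because the
    gradient has no other component. *)
Lemma tangential_fieldE q : U q -> cdom phi q ->
  Y phi q = V q *m H q *m G q - F a1 a1 q *: V q.
Proof.
move=> Uq cq.
have full : V q *m H q *m G q
    = \sum_c \sum_a (fbar f e a phi q * F a c q) *: e c phi q.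
  rewrite [G q]/frame_dual mulmxA mulmx_sum_row; apply: eq_bigr => c _.
  rewrite row_frame -scaler_suml; congr (_ *: _).
  have -> : V q *m H q *m (Ec q)^T
      = (df q *m (Ec q)^T) *m (E q *m H q *m (Ec q)^T).
    by rewrite /grad10 /frame_dual !mulmxA.
  rewrite mxE; apply: eq_bigr => a _.
  by rewrite -fbarE -(chessE phi_atlas e_unitary f a c Uq cq).
rewrite full (bigD1 a1) //= addrAC -[LHS]add0r; congr (_ + _).
rewrite (bigD1 a1) //= big1 => [|a aN]; last by rewrite fbar_eq0 // mul0r scale0r.
by rewrite addr0 grad10_first // scalerA mulrC subrr.
Qed.

(** The metric dual of Y, to be differentiated in place of Y: the constant
    projector replaces the frame. *)
Lemma tangential_field_lower q : U q -> cdom phi q ->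
  Y phi q *m g q = V q *m H q *m P + (-1 * F a1 a1 q) *: (df q *m P).
Proof.
move=> Uq cq; rewrite tangential_fieldE // mulmxBl -[_ *m G q *m _]mulmxA.
rewrite (frame_dual_metric phi_atlas e_unitary Uq cq) -[_ *: V q *m _]scalemxAl.
rewrite -[V q *m g q]mulmxA (frame_dual_metric phi_atlas e_unitary Uq cq).
by rewrite mulN1r scaleNr.
Qed.

Lemma cdiff_chess a b q : U q -> cdom phi q -> cdiff phi (F a b) q.
Proof.
move=> Uq cq.
have d : mxdiff phi (fun q' => E q' *m H q' *m (Ec q')^T) q.
  apply: mxdiffM; last exact: (mxdiff_tr (mxdiff_conj_frame phi_atlas e_unitary Uq cq)).
  apply: mxdiffM; first exact: (mxdiff_frame phi_atlas e_unitary Uq cq).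
  exact: (mxdiff_coord_hess phi_atlas f_smooth cq).
apply: (cdiff_congr phi_chart U_open _ Uq cq (d a b)) => q' Uq' cq'.
by rewrite (chessE phi_atlas e_unitary f a b Uq' cq').
Qed.

Lemma mxdiff_grad10 q : U q -> cdom phi q -> mxdiff phi V q.
Proof.
move=> Uq cq; apply: mxdiffM; first exact: (mxdiff_coord_diff phi_atlas f_smooth cq).
exact: (mxdiff_frame_dual phi_atlas e_unitary Uq cq).
Qed.

Lemma cdiff_opp (s : M -> R[i]) q : cdiff phi s q -> cdiff phi (fun q' => -1 * s q') q.
Proof. by move=> ds; apply: (cdiffM (cdiff_cst phi _ q) ds). Qed.

Lemma mxdiff_tangential_field q : U q -> cdom phi q -> mxdiff phi (Y phi) q.
Proof.
move=> Uq cq; have dV := mxdiff_grad10 Uq cq.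
have d : mxdiff phi (fun q' => V q' *m H q' *m G q' + (-1 * F a1 a1 q') *: V q') q.
  apply: mxdiffD; last exact: (mxdiffZ (cdiff_opp (cdiff_chess a1 a1 Uq cq)) dV).
  apply: mxdiffM; last exact: (mxdiff_frame_dual phi_atlas e_unitary Uq cq).
  by apply: mxdiffM; last exact: (mxdiff_coord_hess phi_atlas f_smooth cq).
apply: (mxdiff_congr phi_chart U_open _ Uq cq d) => q' Uq' cq'.
by rewrite tangential_fieldE // mulN1r scaleNr.
Qed.

Definition tangential_laplacian q := \sum_(c | c != a1) F c c q.
Local Notation h := tangential_laplacian.

(** The difference of [hessian_grad_div] and [scaled_grad_div]: the derivatives
    of the full Laplacian and of [f_{1 1bar}] leave that of the tangential part
    of the Laplacian. *)
Lemma cdiv_tangential_field q : U q -> cdom phi q ->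
  cdiv e Y phi q
  = \sum_a \sum_b `|F a b q| ^+ 2 + cdir phi (V q) h q
    - F a1 a1 q * \sum_a F a a q.
Proof.
move=> Uq cq.
have dY := mxdiff_tangential_field Uq cq.
have d1 := cdiff_chess a1 a1 Uq cq; have d1N := cdiff_opp d1.
have ddf := mxdiff_coord_diff phi_atlas f_smooth cq.
have dH := mxdiff_coord_hess phi_atlas f_smooth cq.
have dV := mxdiff_grad10 Uq cq.
transitivity (\sum_b ((dmx phi (e b phi q) (fun q' => V q' *m H q' *m P) q
      *m (conj_vec (e b phi q))^T) 0 0
    + (dmx phi (e b phi q) (fun q' => (-1 * F a1 a1 q') *: (df q' *m P)) q
      *m (conj_vec (e b phi q))^T) 0 0)).
  apply: eq_bigr => b _.
  rewrite (nabla_mixed phi_atlas cq (sqr_ii R) (frame_jeig phi_atlas e_unitary Uq cq b)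
    (conj_frame_jeig phi_atlas e_unitary Uq cq b) dY).
  rewrite (dmx_congr phi_chart _ U_open tangential_field_lower Uq cq).
  rewrite dmxD; first by rewrite mulmxDl mxE.
    exact: (mxdiffM (mxdiffM dV dH) (mxdiff_cst phi P q)).
  exact: (mxdiffZ d1N (mxdiffM ddf (mxdiff_cst phi P q))).
rewrite big_split /= (hessian_grad_div phi_atlas U_open e_unitary f_smooth Uq cq).
rewrite (scaled_grad_div phi_atlas e_unitary f_smooth Uq cq d1N).
rewrite -(norm_chessE phi_atlas e_unitary f_smooth Uq cq).
rewrite -(laplaceE phi_atlas e_unitary f Uq cq).
have -> : cdir phi (V q) (fun q' => \tr (H q' *m G q')) q
    = cdir phi (V q) (F a1 a1) q + cdir phi (V q) h q.
  have dh : cdiff phi h q.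
    by apply: (cdiff_sum _ _ (fun c => cdiff_chess c c Uq cq)).
  rewrite -(cdirD _ d1 dh).
  apply: (cdir_congr phi_chart _ U_open _ Uq cq) => q' Uq' cq'.
  by rewrite -(laplaceE phi_atlas e_unitary f Uq' cq') (bigD1 a1).
rewrite (cdirM phi_chart _ cq (cdiff_cst phi _ q) d1) cdir_cst mul0r add0r.
by ring.
Qed.

Lemma tangential_laplacian_real q : U q -> cdom phi q -> conjc (h q) = h q.
Proof.
move=> Uq cq; rewrite rmorph_sum; apply: eq_bigr => c _.
exact: (conj_chess phi_atlas e_unitary f_smooth c c Uq cq).
Qed.

Lemma grad10_real q : U q -> cdom phi q ->
  V q + map_mx (@conjc R) (V q) = cmx (grad f phi q).
Proof.
move=> Uq cq.
have EcK : map_mx (@conjc R) (Ec q) = E q := conjc_mxK _.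
have -> : map_mx (@conjc R) (V q) = df q *m (G q)^T.
  rewrite /grad10 map_mxM /= conj_cmx; congr (_ *m _).
  by rewrite /frame_dual map_mxM -map_trmx EcK trmx_mul trmxK.
rewrite /grad10 -mulmxDr (frame_complete phi_atlas e_unitary Uq cq).
by rewrite /= -cmxM.
Qed.

(** The gradient is the sum of its (1,0) part and the conjugate, and the
    derivative of a real function commutes with conjugation. *)
Lemma Re_cdir_grad10 q : U q -> cdom phi q ->
  real_complex R (complex.Re (cdir phi (V q) h q))
  = 2^-1 * cdir phi (cmx (grad f phi q)) h q.
Proof.
move=> Uq cq; rewrite ReJ_add mulrC; congr (_ * _).
have conj_cpd i : conjc (cpd phi i h q) = cpd phi i h q.
  have im0 : pd phi i (fun q' => complex.Im (h q')) q = 0.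
    rewrite -(pd_cst phi i (0 : R) q).
    apply: (pd_congr phi_chart U_open _ _ Uq cq) => q' Uq' cq'.
    have := tangential_laplacian_real Uq' cq'.
    case: (h q') => x y [/eqP]; rewrite eq_sym -addr_eq0 -mulr2n mulrn_eq0 /=.
    by move/eqP.
  by rewrite /cpd im0 /= oppr0.
rewrite -(grad10_real Uq cq) /cdir rmorph_sum -big_split /=.
apply: eq_bigr => i _.
have -> : conjc (V q 0 i * cpd phi i h q) = conjc (V q 0 i) * cpd phi i h q.
  by rewrite -[in RHS]conj_cpd; exact: rmorphM.
rewrite -mulrDl; congr (_ * _).
by rewrite [RHS]mxE [X in _ = _ + X]mxE.
Qed.

Lemma grad_cgrad q : U q -> cdom phi q ->
  cbil (metric phi q) (cmx (grad f phi q)) (cgrad h phi q)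
  = cdir phi (cmx (grad f phi q)) h q.
Proof.
move=> Uq cq; rewrite /cbil /cgrad trmx_mul -cmx_tr cmx_inv_tr // !mulmxA.
rewrite -[_ *m g q *m _]mulmxA -cmxM mulmxV ?metric_unit // /cmx map_mx1 mulmx1.
by rewrite mxE; apply: eq_bigr => i _; rewrite [_^T _ _]mxE [X in _ * X]mxE.
Qed.

(** The real part of [cdiv_tangential_field], all other terms there being
    real. *)
Lemma bochner_identity q : U q -> cdom phi q ->
  2^-1 * cbil (metric phi q) (cmx (grad f phi q)) (cgrad h phi q)
  = F a1 a1 q * (\sum_a F a a q) - \sum_a \sum_b `|F a b q| ^+ 2
    + real_complex R (complex.Re (cdiv e Y phi q)).
Proof.
move=> Uq cq; rewrite grad_cgrad // cdiv_tangential_field //.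
rewrite -Re_cdir_grad10 // (ReJ_add (_ - _)) (ReJ_add (cdir _ _ _ _)).
have chess_conj a b := conj_chess phi_atlas e_unitary f_smooth a b Uq cq.
have Lr : conjc (\sum_a F a a q) = \sum_a F a a q.
  by rewrite rmorph_sum; apply: eq_bigr => a _; apply: chess_conj.
have normr (x : R[i]) : conjc (`|x| ^+ 2) = `|x| ^+ 2.
  rewrite sqr_normc; apply: (etrans (rmorphM (@conjc R) _ _)).
  by rewrite /= conjcK mulrC.
have Nr : conjc (\sum_a \sum_b `|F a b q| ^+ 2) = \sum_a \sum_b `|F a b q| ^+ 2.
  rewrite rmorph_sum; apply: eq_bigr => a _; rewrite rmorph_sum.
  by apply: eq_bigr => b _; apply: normr.
rewrite rmorphB rmorphD rmorphM /= Lr Nr chess_conj.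
by field.
Qed.

End MainIdentity.

Theorem proposition1 (R : realType) (m : nat) (hm : (1 < m)%N)
    (M : kahlerManifold R m) (Mcomplete : complete_manifold M)
    (f : M -> R) (fsmooth : smooth_fun f)
    (p : M)
    (gradf_neq0 : forall phi, atlas phi -> cdom phi p -> grad f phi p != 0)
    (U : set M) (Uopen : open U) (Up : U p)
    (e : 'I_m -> cvfield R m M) (eunitary : unitary_frame U e) :
  let i1 : 'I_m := Ordinal (ltnW hm) in
  (forall phi q, atlas phi -> U q -> cdom phi q ->
     e i1 phi q = grad_frame_vector f phi q) ->
  let Y : cvfield R m M := fun phi q =>
    \sum_(c | c != i1) \sum_a
      (fbar f e a phi q * chess f e a c phi q) *: e c phi q in
  \forall q \near p, forall phi, atlas phi -> cdom phi q ->
    2^-1 * cbil (metric phi q) (cmx (grad f phi q))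
             (cgrad (fun q' => \sum_(c | c != i1) chess f e c c phi q') phi q)
    = chess f e i1 i1 phi q * (\sum_a chess f e a a phi q)
      - \sum_a \sum_b `|chess f e a b phi q| ^+ 2
      + real_complex R (complex.Re (cdiv e Y phi q)).
Proof.
move=> i1 e_grad Y.
apply: filterS (open_nbhs_nbhs (conj Uopen Up)) => q Uq phi phi_atlas cq.
apply: (bochner_identity phi_atlas Uopen eunitary fsmooth _ Uq cq).
by move=> q' Uq' cq'; apply: e_grad.
Qed.
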